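(* Let $d\ge2$ be a nonsquare integer with fundamental solution $(X_1,Y_1)$ of $x^2-dy^2=1$, and consider the five programs SC, SO, QC, QO, QT defined in the context, with inputs $d,K,w$ subject to the respective conditions on $K,w$ listed there. With $\sigma=K^2(K-1)/2$, make the following choices of the parameter $e$ in the Hamming-weight calls $\mathsf H(\cdot,e)$: - (HW-C) for SC and QC: $e=w(2K+1)(\sigma+2K)$; - (HW-O) for SO and QO: $e=w(\sigma+2K)$; - (HW-T) for QT: $e=w(\sigma+2K)$, used in both calls. These three choices satisfy $\mathrm{HW}(m)<e\le2m$ for their respective arguments $m$ (namely $m=M$ for SC, QC, SO, QO, and $m=M_x$, $m=M_y$ for QT). With these choices and $K\ge d$, the largest intermediate bit lengths are bounded by $$2^{O(K^8)}\text{ for SC},\qquad 2^{O(K^6)}\text{ for SO},\qquad 2^{O(wK^4)}\text{ for QC},\qquad 2^{O(wK^3)}\text{ for QO and QT}.$$ Under the elementary parameters these are $2^{2^{O(d)}}$, and under the Hua parameters they are $2^{2^{O(\sqrt d\log d)}}$.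
   Context: The fundamental solution is the solution of $x^2-dy^2=1$ in positive integers with $X_1$ least. $\mathrm{HW}(m)$ is the Hamming weight of $m$, i.e. the number of ones in its binary expansion. All values are in $\mathbb N=\{0,1,2,\dots\}$; $u\mathbin{\dot{-}}v=\max(u-v,0)$; $u\bmod v$ is the remainder; divisors are positive. The constants implied by $O(\cdot)$ are absolute. Intermediates are all values computed by the entire program, including inside the subroutine $\mathsf H$. Conditions on the integers $K,w$: in all cases $K>X_1$. SC: $K\ge64$, $w=(2K)^4$. SO: $K\ge64$, $w=(2K)^3$. QC and QT: $2^w\ge d^2K^4$. QO: $w\ge d$ and $2^w\ge d^2K^4$. Elementary parameters: $K=64^d$, with $w=(2K)^4$ for SC, $w=(2K)^3$ for SO, and $w=26d$ for QC, QO, QT. Hua parameters: $r=\bigl\lfloor4^d/\binom{2d}{d}\bigr\rfloor$, $K=(32d)^r$, with $w=(2K)^4$ for SC, $w=(2K)^3$ for SO, and $w=(4r+2)(d+5)$ for QC, QO, QT. (Here $r$ is computed by $h_d=2d$, $L_d=2^{h_d}$, $c_d=\lfloor(L_d+1)^{h_d}/L_d^d\rfloor\bmod L_d$, $r=\lfloor L_d/c_d\rfloor$.) Subroutines (local variables of subroutines are separate): $\mathsf G_{02}(Q,K,t)$ returns $(G_0,G_2)$: $u=Q\mathbin{\dot{-}}1$, $Z_Q=Q^K$, $v=ut$, $Q_+=Q+1$, $u_3=u^3$, $G_0=\lfloor Z_Q/u\rfloor$, $z=v\mathbin{\dot{-}}2$, $g_2=vz+Q_+$, $G_2=\lfloor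 Z_Qg_2/u_3\rfloor$. $\mathsf G_{024}(Q,K,t)$ returns $(G_0,G_2,G_4)$: the preceding assignments, then $u_5=u^5$, $h=Q_+(Q+9)$, $g_4=g_2g_2+Q\bigl((4v)(z\mathbin{\dot{-}}Q_+)+h\bigr)$, $G_4=\lfloor Z_Qg_4/u_5\rfloor$. In both, a fourth argument, when present, supplies the already computed $Z_Q=Q^K$. $\mathsf H(m,e)$: $a=2m$, $L=2^a$, $\Pi=2^e$, $\alpha=\lfloor(L+1)^a/L^m\rfloor\bmod\Pi$, $\gamma=\alpha\Pi$, $g=\Bigl(\Bigl\lfloor\frac{2^{\gamma(\gamma+\alpha+\Pi)}}{(2^{\gamma\alpha}\mathbin{\dot{-}}1)(2^{\gamma\Pi}\mathbin{\dot{-}}1)}\Bigr\rfloor\bmod2^\gamma\Bigr)\mathbin{\dot{-}}1$, $u=\Pi\mathbin{\dot{-}}1$, output $\lfloor(g^e\bmod u^2)/u\rfloor$. $\mathsf S(U,V)=P_-\bigl[V_0((P+2)U_0\mathbin{\dot{-}}U_2)+U_0(dV_2)\bigr]$. $\mathsf T(U,V)$: $D_2=dV_2$, output $P_-\bigl[\bigl(V_0(PU_0\mathbin{\dot{-}}U_4)+2U_2(V_0+D_2)\bigr)\mathbin{\dot{-}}U_0(2D_2+d_2V_4)\bigr]$, where $d_2=dd$. $\mathsf C(d,K,A,p,v)$: $h=2K$, $z_c=p+1$, $c_K=\lfloor z_c^h/v\rfloor\bmod p$, $H_c=dh$, $c_{dK}=\lfloor z_c^{H_c}/v^d\rfloor\bmod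 p$, $a_c=2^{H_c\mathbin{\dot{-}}h}c_K$, output $\lfloor Ac_{dK}/a_c\rfloor$. $\mathsf R(d,A,B)$: $V_B=d(BB)$, $c=(AA\mathbin{\dot{-}}A)\mathbin{\dot{-}}V_B$, $V_c=cc$, $D_c=V_c\mathbin{\dot{-}}V_B$, output $\bigl(\lfloor(V_c+V_B)/D_c\rfloor,\lfloor(2B)c/D_c\rfloor\bigr)$. Programs. All begin with $t=K\mathbin{\dot{-}}1$, $P=2^w$, $P_-=P\mathbin{\dot{-}}1$, then $q=P^3$ (for SC, SO) or $q=PP$ (for QC, QO, QT), $q_1=q^K$, $q_2=q_1^K$; all compute $\sigma=\lfloor(KK)t/2\rfloor$ and, before the Hamming-weight call(s), the value $e$ chosen in the claim. SC: $q_3=q_2^K$, $Q_x=q_1q_2$, $Q_y=q(q_3q_3)$, $(U_0,U_2)=\mathsf G_{02}(Q_x,K,t)$, $(V_0,V_2)=\mathsf G_{02}(Q_y,K,t)$, $T_s=\mathsf S(U,V)$, $M=\lfloor T_s/(q_2\mathbin{\dot{-}}1)\rfloor$, $H_M=\mathsf H(M,e)$, $C=2K$, $C_+=C+1$, $W_C=C_+\sigma$, $R_C=\lfloor H_M/w\rfloor\mathbin{\dot{-}}W_C$, $A=R_C\bmod C$, $B=\lfloor R_C/C\rfloor$; return $\mathsf R(d,A,B)$. QC: as SC, but with $(U_0,U_2,U_4)=\mathsf G_{024}(Q_x,K,t)$, $(V_0,V_2,V_4)=\mathsf G_{024}(Q_y,K,t)$ and $T_q=\mathsf T(U,V)$ in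 place of $T_s$. SO: $Q=q_1q_2$, $(U_0,U_2)=\mathsf G_{02}(Q,K,t)$, $(V_0,V_2)=\mathsf G_{02}(q,K,t,q_1)$, $T_s=\mathsf S(U,V)$, $M=\lfloor T_s/(q_2\mathbin{\dot{-}}1)\rfloor$, $H_M=\mathsf H(M,e)$, $A=\lfloor H_M/w\rfloor\mathbin{\dot{-}}\sigma$, $B=\mathsf C(d,K,A,q_1,q_2)$; return $\mathsf R(d,A,B)$. QO: as SO, but with $(U_0,U_2,U_4)=\mathsf G_{024}(Q,K,t)$, $(V_0,V_2,V_4)=\mathsf G_{024}(q,K,t,q_1)$ and $T_q=\mathsf T(U,V)$ in place of $T_s$. QT: $Q=q_1q_2$, $U=\mathsf G_{024}(Q,K,t)$, $V=\mathsf G_{024}(q,K,t,q_1)$, $T_x=\mathsf T(U,V)$, $T_y=\mathsf T(V,U)$, $D_q=q_2\mathbin{\dot{-}}1$, $M_x=\lfloor T_x/D_q\rfloor$, $M_y=\lfloor T_y/D_q\rfloor$, $H_x=\mathsf H(M_x,e)$, $H_y=\mathsf H(M_y,e)$, $A=\lfloor H_x/w\rfloor\mathbin{\dot{-}}\sigma$, $B=\lfloor H_y/w\rfloor\mathbin{\dot{-}}\sigma$; return $\mathsf R(d,A,B)$. *)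

(* Defs.v *)
From mathcomp Require Import all_boot.

Set Implicit Arguments.
Unset Strict Implicit.
Unset Printing Implicit Defensive.

Local Open Scope nat_scope.

(* Least k with n < 2 ^ k: the number of binary digits of n (0 for n = 0). *)
Definition bitlen (n : nat) : nat := up_log 2 n.+1.

Definition HW (n : nat) : nat := \sum_(i < bitlen n) odd (n %/ 2 ^ i).

Definition nonsquare (d : nat) : Prop := forall n, d <> n ^ 2.

Definition pell (d x y : nat) : Prop := [/\ 0 < x, 0 < y & x ^ 2 = d * y ^ 2 + 1].

Definition fundamental_solution (d X1 Y1 : nat) : Prop :=
  pell d X1 Y1 /\ forall x y, pell d x y -> X1 <= x.

(* Straight-line arithmetic on nat. Expressions are syntactic so that the value
   of every operation occurring in a program is recorded as an intermediate. *)
Inductive binop := Add | Monus | Mul | Div | Mod | Pow.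

Inductive expr := Val of nat | Bin of binop & expr & expr.

Definition apply_op (o : binop) : nat -> nat -> nat :=
  match o with
  | Add => addn | Monus => subn | Mul => muln
  | Div => divn | Mod => modn | Pow => expn
  end.

Fixpoint eval (x : expr) : nat :=
  match x with
  | Val n => n
  | Bin o x1 x2 => apply_op o (eval x1) (eval x2)
  end.

Fixpoint subvalues (x : expr) : seq nat :=
  match x with
  | Val _ => [::]
  | Bin _ x1 x2 => subvalues x1 ++ subvalues x2 ++ [:: eval x]
  end.

Coercion Val : nat >-> expr.

Declare Scope expr_scope.
Delimit Scope expr_scope with X.
Bind Scope expr_scope with expr.
Notation "x + y" := (Bin Add x y) : expr_scope.
Notation "x - y" := (Bin Monus x y) : expr_scope.
Notation "x * y" := (Bin Mul x y) : expr_scope.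
Notation "x %/ y" := (Bin Div x y) : expr_scope.
Notation "x %% y" := (Bin Mod x y) : expr_scope.
Notation "x ^ y" := (Bin Pow x y) : expr_scope.

(* Outcome of a computation: its output, all values computed on the way, and
   the argument pairs (m, e) of the calls to the Hamming-weight subroutine. *)
Record run (A : Type) := Run {
  output : A;
  intermediates : seq nat;
  hw_calls : seq (nat * nat) }.

Definition ret A (a : A) : run A := Run a [::] [::].

Definition calc (x : expr) : run nat := Run (eval x) (subvalues x) [::].

Definition bind A B (c : run A) (k : A -> run B) : run B :=
  let c' := k (output c) in
  Run (output c') (intermediates c ++ intermediates c') (hw_calls c ++ hw_calls c').

Definition record_hw_call (m e : nat) : run unit := Run tt [::] [:: (m, e)].

Declare Scope run_scope.
Delimit Scope run_scope with run.
Bind Scope run_scope with run.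
Local Open Scope run_scope.

Notation "'LET' x ':=' e ';' k" := (bind (calc e%X) (fun x => k))
  (at level 200, x name, e at level 100, k at level 200, right associativity)
  : run_scope.
Notation "'CALL' p ':=' c ';' k" := (bind c (fun p => k))
  (at level 200, p pattern, c at level 100, k at level 200, right associativity)
  : run_scope.

(* oZ carries Q ^ K when it is already available. *)
Definition power_if_needed (Q K : nat) (oZ : option nat) : run nat :=
  if oZ is Some Z then ret Z else calc (Q ^ K)%X.

Definition G02 (Q K t : nat) (oZ : option nat) : run (nat * nat) :=
  LET u := Q - 1;
  CALL Z := power_if_needed Q K oZ;
  LET v := u * t;
  LET Qp := Q + 1;
  LET u3 := u ^ 3;
  LET G0 := Z %/ u;
  LET z := v - 2;
  LET g2 := v * z + Qp;
  LET G2 := (Z * g2) %/ u3;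
  ret (G0, G2).

Definition G024 (Q K t : nat) (oZ : option nat) : run (nat * nat * nat) :=
  LET u := Q - 1;
  CALL Z := power_if_needed Q K oZ;
  LET v := u * t;
  LET Qp := Q + 1;
  LET u3 := u ^ 3;
  LET G0 := Z %/ u;
  LET z := v - 2;
  LET g2 := v * z + Qp;
  LET G2 := (Z * g2) %/ u3;
  LET u5 := u ^ 5;
  LET h := Qp * (Q + 9);
  LET g4 := g2 * g2 + Q * ((4 * v) * (z - Qp) + h);
  LET G4 := (Z * g4) %/ u5;
  ret (G0, G2, G4).

Definition Hsub (m e : nat) : run nat :=
  CALL _ := record_hw_call m e;
  LET a := 2 * m;
  LET L := 2 ^ a;
  LET Pi := 2 ^ e;
  LET alpha := (((L + 1) ^ a) %/ (L ^ m)) %% Pi;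
  LET gamma := alpha * Pi;
  LET g :=
    (((2 ^ (gamma * (gamma + alpha + Pi)))
      %/ ((2 ^ (gamma * alpha) - 1) * (2 ^ (gamma * Pi) - 1)))
     %% (2 ^ gamma)) - 1;
  LET u := Pi - 1;
  calc (((g ^ e) %% (u ^ 2)) %/ u)%X.

Definition Ssub (d P Pm : nat) (U V : nat * nat) : run nat :=
  let: (U0, U2) := U in
  let: (V0, V2) := V in
  calc (Pm * (V0 * ((P + 2) * U0 - U2) + U0 * (d * V2)))%X.

Definition Tsub (d P Pm : nat) (U V : nat * nat * nat) : run nat :=
  let: (U0, U2, U4) := U in
  let: (V0, V2, V4) := V in
  LET D2 := d * V2;
  LET d2 := d * d;
  calc (Pm * ((V0 * (P * U0 - U4) + 2 * U2 * (V0 + D2))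
              - U0 * (2 * D2 + d2 * V4)))%X.

Definition Csub (d K A p v : nat) : run nat :=
  LET h := 2 * K;
  LET zc := p + 1;
  LET cK := ((zc ^ h) %/ v) %% p;
  LET Hc := d * h;
  LET cdK := ((zc ^ Hc) %/ (v ^ d)) %% p;
  LET ac := 2 ^ (Hc - h) * cK;
  calc ((A * cdK) %/ ac)%X.

Definition Rsub (d A B : nat) : run (nat * nat) :=
  LET VB := d * (B * B);
  LET c := (A * A - A) - VB;
  LET Vc := c * c;
  LET Dc := Vc - VB;
  LET X := (Vc + VB) %/ Dc;
  LET Y := ((2 * B) * c) %/ Dc;
  ret (X, Y).

Inductive variant := SC | SO | QC | QO | QT.

(* The parameter e of the Hamming-weight calls, sigma being K^2 (K - 1) / 2. *)
Definition hw_choice (v : variant) (K w sigma : nat) : expr :=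
  match v with
  | SC | QC => w * (2 * K + 1) * (sigma + 2 * K)
  | SO | QO | QT => w * (sigma + 2 * K)
  end%X.

Definition decode_C (d K w sigma HM : nat) : run (nat * nat) :=
  LET C := 2 * K;
  LET Cp := C + 1;
  LET WC := Cp * sigma;
  LET RC := HM %/ w - WC;
  LET A := RC %% C;
  LET B := RC %/ C;
  Rsub d A B.

Definition decode_O (d K w sigma q1 q2 HM : nat) : run (nat * nat) :=
  LET A := HM %/ w - sigma;
  CALL B := Csub d K A q1 q2;
  Rsub d A B.

Definition program_SC (d K w : nat) : run (nat * nat) :=
  LET t := K - 1;
  LET P := 2 ^ w;
  LET Pm := P - 1;
  LET q := P ^ 3;
  LET q1 := q ^ K;
  LET q2 := q1 ^ K;
  LET sigma := ((K * K) * t) %/ 2;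
  LET e := hw_choice SC K w sigma;
  LET q3 := q2 ^ K;
  LET Qx := q1 * q2;
  LET Qy := q * (q3 * q3);
  CALL U := G02 Qx K t None;
  CALL V := G02 Qy K t None;
  CALL Ts := Ssub d P Pm U V;
  LET M := Ts %/ (q2 - 1);
  CALL HM := Hsub M e;
  decode_C d K w sigma HM.

Definition program_QC (d K w : nat) : run (nat * nat) :=
  LET t := K - 1;
  LET P := 2 ^ w;
  LET Pm := P - 1;
  LET q := P * P;
  LET q1 := q ^ K;
  LET q2 := q1 ^ K;
  LET sigma := ((K * K) * t) %/ 2;
  LET e := hw_choice QC K w sigma;
  LET q3 := q2 ^ K;
  LET Qx := q1 * q2;
  LET Qy := q * (q3 * q3);
  CALL U := G024 Qx K t None;
  CALL V := G024 Qy K t None;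
  CALL Tq := Tsub d P Pm U V;
  LET M := Tq %/ (q2 - 1);
  CALL HM := Hsub M e;
  decode_C d K w sigma HM.

Definition program_SO (d K w : nat) : run (nat * nat) :=
  LET t := K - 1;
  LET P := 2 ^ w;
  LET Pm := P - 1;
  LET q := P ^ 3;
  LET q1 := q ^ K;
  LET q2 := q1 ^ K;
  LET sigma := ((K * K) * t) %/ 2;
  LET e := hw_choice SO K w sigma;
  LET Q := q1 * q2;
  CALL U := G02 Q K t None;
  CALL V := G02 q K t (Some q1);
  CALL Ts := Ssub d P Pm U V;
  LET M := Ts %/ (q2 - 1);
  CALL HM := Hsub M e;
  decode_O d K w sigma q1 q2 HM.

Definition program_QO (d K w : nat) : run (nat * nat) :=
  LET t := K - 1;
  LET P := 2 ^ w;
  LET Pm := P - 1;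
  LET q := P * P;
  LET q1 := q ^ K;
  LET q2 := q1 ^ K;
  LET sigma := ((K * K) * t) %/ 2;
  LET e := hw_choice QO K w sigma;
  LET Q := q1 * q2;
  CALL U := G024 Q K t None;
  CALL V := G024 q K t (Some q1);
  CALL Tq := Tsub d P Pm U V;
  LET M := Tq %/ (q2 - 1);
  CALL HM := Hsub M e;
  decode_O d K w sigma q1 q2 HM.

Definition program_QT (d K w : nat) : run (nat * nat) :=
  LET t := K - 1;
  LET P := 2 ^ w;
  LET Pm := P - 1;
  LET q := P * P;
  LET q1 := q ^ K;
  LET q2 := q1 ^ K;
  LET sigma := ((K * K) * t) %/ 2;
  LET e := hw_choice QT K w sigma;
  LET Q := q1 * q2;
  CALL U := G024 Q K t None;
  CALL V := G024 q K t (Some q1);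
  CALL Tx := Tsub d P Pm U V;
  CALL Ty := Tsub d P Pm V U;
  LET Dq := q2 - 1;
  LET Mx := Tx %/ Dq;
  LET My := Ty %/ Dq;
  CALL Hx := Hsub Mx e;
  CALL Hy := Hsub My e;
  LET A := Hx %/ w - sigma;
  LET B := Hy %/ w - sigma;
  Rsub d A B.

Definition program (v : variant) : nat -> nat -> nat -> run (nat * nat) :=
  match v with
  | SC => program_SC
  | SO => program_SO
  | QC => program_QC
  | QO => program_QO
  | QT => program_QT
  end.

Definition admissible (v : variant) (d K w X1 : nat) : Prop :=
  X1 < K /\
  match v with
  | SC => 64 <= K /\ w = (2 * K) ^ 4
  | SO => 64 <= K /\ w = (2 * K) ^ 3
  | QC | QT => d ^ 2 * K ^ 4 <= 2 ^ w
  | QO => d <= w /\ d ^ 2 * K ^ 4 <= 2 ^ w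
  end.

Definition max_bitlen A (c : run A) : nat := \max_(n <- intermediates c) bitlen n.

(* The exponent f in the bound 2 ^ O(f) on the bit lengths. *)
Definition bit_exponent (v : variant) (K w : nat) : nat :=
  match v with
  | SC => K ^ 8
  | SO => K ^ 6
  | QC => w * K ^ 4
  | QO | QT => w * K ^ 3
  end.

Definition elementary_K (d : nat) : nat := 64 ^ d.

Definition elementary_w (v : variant) (d : nat) : nat :=
  match v with
  | SC => (2 * elementary_K d) ^ 4
  | SO => (2 * elementary_K d) ^ 3
  | QC | QO | QT => 26 * d
  end.

Definition hua_r (d : nat) : nat := 4 ^ d %/ 'C(2 * d, d).

Definition hua_K (d : nat) : nat := (32 * d) ^ hua_r d.

Definition hua_w (v : variant) (d : nat) : nat :=
  match v with
  | SC => (2 * hua_K d) ^ 4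
  | SO => (2 * hua_K d) ^ 3
  | QC | QO | QT => (4 * hua_r d + 2) * (d + 5)
  end.

(* The computation of hua_r without binomial coefficients. *)
Definition hua_r_computation (d : nat) : run nat :=
  LET h := 2 * d;
  LET L := 2 ^ h;
  LET c := (((L + 1) ^ h) %/ (L ^ d)) %% L;
  calc (L %/ c)%X.

(* Main.v *)
Require Import Defs.
From mathcomp Require Import all_boot all_order all_algebra.
From mathcomp Require Import all_classical all_reals all_analysis.
From mathcomp Require Import zify ring lra.

(** The divisions in [G02] and [G024] are the floors of closed forms of the power
    sums [Sum_(k < K) k ^ j * Q ^ k], so [Ssub] and [Tsub] return
    [(P - 1) * Sum_(x, y < K) n x y * A ^ x * B ^ y], where [n x y] is
    [P + 2 - (x ^ 2 - d * y ^ 2)] or [P + 1 - (x ^ 2 - d * y ^ 2 - 1) ^ 2]. The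
    product [(2 ^ w - 1) * n] has weight [w] when [1 <= n <= 2 ^ w] and [2 * w] when
    [n = 2 ^ w + 1], which happens exactly when [(x, y)] solves the Pell equation;
    the first kind of digit can also exceed [2 ^ w + 1], which costs a few ones.

    The bases are such that [A ^ x * B ^ y = q ^ rho * q2 ^ s], where
    [q2 = q ^ (K ^ 2)], the exponent [rho] enumerates the grid, and [s] is a linear
    form in [x] and [y]. Dividing by [q2 - 1] repeats each digit [s] times. For an
    upper bound on the weight of the quotient it is enough that weights are
    subadditive ([HW_addn], [HW_divn_sum]): there are [w] ones for each unit of [s]
    in the whole grid, which gives the term with [sigma], and [w] more for each
    unit of [s] at a Pell solution. From the second solution on, the abscissas at
    least triple at each step ([pell_pairs_gap]), so their sum below [K] is at most
    [(3 * K - 1) / 2], short of the [2 * K] granted by the choice of [e]; the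
    remaining [K / 2] absorbs the errors ([hw_window]). The other inequality is
    crude, as [M] is at least its last digit, shifted to its place.

    For the bit lengths fix the scale [f = w * K ^ 4], or [w * K ^ 3] when the
    coordinates are recovered separately. All numbers up to [M], and also [2 ^ e],
    are [2 ^ O(f)]; every later exponentiation has an exponent of that size and a
    base of size at most [2 ^ 2 ^ O(f)]. The rules of a small program logic
    ([run_spec], [double_pow]) propagate these two sizes with explicit constants
    through the programs ([max_bitlen_program_leq]).

    The elementary parameters are then substituted. For the Hua parameters the
    central binomial coefficient is at least [4 ^ d / (2 * sqrt d)], so
    [r <= 2 * sqrt d] and [K = (32 * d) ^ r] is the exponential of
    [O(sqrt d * ln d)]. *)

Set Implicit Arguments.
Unset Strict Implicit.
Unset Printing Implicit Defensive.

Local Open Scope nat_scope.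

(** * Hamming weight *)

Lemma ltn_bitlen n : n < 2 ^ bitlen n.
Proof. exact: up_logP. Qed.

Lemma bitlen_leq n k : (bitlen n <= k) = (n < 2 ^ k).
Proof.
apply/idP/idP => [le_k|]; last by apply: up_log_min.
by apply: leq_trans (ltn_bitlen n) _; rewrite leq_exp2l.
Qed.

Lemma HW_truncated n k : n < 2 ^ k -> HW n = \sum_(i < k) odd (n %/ 2 ^ i).
Proof.
move=> nk; have le_k: bitlen n <= k by rewrite bitlen_leq.
rewrite /HW -(big_mkord xpredT (fun i => nat_of_bool (odd (n %/ 2 ^ i)))).
rewrite -(big_mkord xpredT (fun i => nat_of_bool (odd (n %/ 2 ^ i)))).
rewrite (big_cat_nat (leq0n _) le_k) /= -[LHS]addn0; congr (_ + _).
rewrite big_nat big1 // => i /andP[bi _]; rewrite divn_small //.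
by rewrite (leq_trans (ltn_bitlen n)) ?leq_exp2l.
Qed.

Lemma HW0 : HW 0 = 0.
Proof. by rewrite (@HW_truncated 0 0) ?big_ord0. Qed.

Lemma HW_half n : HW n = odd n + HW n./2.
Proof.
have n_lt := ltn_bitlen n.
have h_lt: n./2 < 2 ^ bitlen n by lia.
have n_lt' : n < 2 ^ (bitlen n).+1 by rewrite expnS; lia.
rewrite (HW_truncated n_lt') (HW_truncated h_lt) big_ord_recl expn0 divn1.
by congr (_ + _); apply: eq_bigr => i _; rewrite -divn2 -divnMA -expnS.
Qed.

Lemma HW1 : HW 1 = 1.
Proof. by rewrite HW_half HW0. Qed.

Lemma HW_leq_length n k : n < 2 ^ k -> HW n <= k.
Proof.
move=> nk; rewrite (HW_truncated nk) -[leqRHS]card_ord -sum1_card.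
by apply: leq_sum => i _; case: odd.
Qed.

(** A carry replaces two ones by a single one, so carries only lose weight. *)
Lemma HW_addn a b : HW (a + b) <= HW a + HW b.
Proof.
have [n] := ubnP (a + b); elim: n a b => // n IHn a b abn.
have [->|a0] := posnP a; first by rewrite HW0.
have [->|b0] := posnP b; first by rewrite HW0 !addn0.
rewrite (HW_half (a + b)) (HW_half a) (HW_half b) halfD oddD.
case oa: (odd a); case ob: (odd b); rewrite /= ?add0n.
- have le1 := IHn 1 (a./2 + b./2) ltac:(lia).
  have le2 := IHn (a./2) (b./2) ltac:(lia).
  by rewrite HW1 in le1; lia.
all: by have le2 := IHn (a./2) (b./2) ltac:(lia); lia.
Qed.

Lemma HW_shift n k : HW (n * 2 ^ k) = HW n.
Proof.
elim: k => [|k IHk]; first by rewrite muln1.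
by rewrite expnS mulnCA HW_half mul2n doubleK odd_double.
Qed.

Lemma HW_sum (I : Type) (r : seq I) (Q : pred I) (F : I -> nat) :
  HW (\sum_(i <- r | Q i) F i) <= \sum_(i <- r | Q i) HW (F i).
Proof.
elim/big_ind2: _ => [|a1 b1 a2 b2 le1 le2|//]; first by rewrite HW0.
exact: leq_trans (HW_addn _ _) (leq_add le1 le2).
Qed.

(** Complementing the [w] digits of [a] exchanges zeros and ones. *)
Lemma HW_complement w a : a < 2 ^ w -> HW a + HW ((2 ^ w).-1 - a) = w.
Proof.
elim: w a => [|w IHw] a; first by rewrite expn0; case: a => // _; rewrite HW0.
rewrite expnS => aw; rewrite (HW_half a) (HW_half (_ - a)).
have ah: a./2 < 2 ^ w by lia.
have := IHw _ ah.
have -> : ((2 * 2 ^ w).-1 - a)./2 = (2 ^ w).-1 - a./2 by lia.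
have -> : odd ((2 * 2 ^ w).-1 - a) = ~~ odd a by lia.
lia.
Qed.

(** The upper half of [(2 ^ w - 1) * n = (n - 1) * 2 ^ w + (2 ^ w - n)] is [n - 1]
    and its lower half is the complement of [n - 1]. *)
Lemma HW_mul_ones w n : 0 < n <= 2 ^ w -> HW ((2 ^ w - 1) * n) <= w.
Proof.
case/andP; case: n => // n _ nw.
have -> : (2 ^ w - 1) * n.+1 = n * 2 ^ w + ((2 ^ w).-1 - n) by nia.
by apply: leq_trans (HW_addn _ _) _; rewrite HW_shift HW_complement.
Qed.

(** Past [2 ^ w + 1] the product is
    [2 ^ (2 * w) + (m - 1) * 2 ^ w + (2 ^ w - 1 - m)], whose middle part is as
    short as [m]. *)
Lemma HW_mul_ones_over w m k :
  0 < m < 2 ^ k -> m < 2 ^ w -> HW ((2 ^ w - 1) * (2 ^ w + 1 + m)) <= w + k.+1.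
Proof.
move=> /andP[m0 mk] mw.
have -> : (2 ^ w - 1) * (2 ^ w + 1 + m) =
   1 * 2 ^ (w + w) + (m.-1 * 2 ^ w + (2 ^ w - m.+1)) by rewrite expnD; nia.
apply: leq_trans (HW_addn _ _) _; rewrite HW_shift.
have := HW_addn (m.-1 * 2 ^ w) (2 ^ w - m.+1); rewrite HW_shift.
have := @HW_leq_length m.-1 k ltac:(lia).
have := @HW_leq_length (2 ^ w - m.+1) w ltac:(lia).
have := @HW_leq_length 1 1 isT.
lia.
Qed.

(** * Closed forms of the power sums *)

Section PowerSumIdentities.
Import GRing.Theory.
Local Open Scope ring_scope.

(** Here [t] is one less than the number of terms: in terms of
    [v = (Q - 1) * t] the closed form of the sum is the one that [G02] and [G024]
    evaluate, except for a correction that does not depend on [t]. *)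
Lemma power_sum2 (R : comNzRingType) (Q : R) (t : nat) :
  let v := (Q - 1) * t%:R in
  (Q - 1) ^+ 3 * (\sum_(k < t.+1) k%:R ^+ 2 * Q ^+ k) =
  Q ^+ t.+1 * (v * (v - 2%:R) + (Q + 1)) - Q * (Q + 1).
Proof.
elim: t => [|t /= IHt]; first by rewrite big_ord1 /=; ring.
rewrite big_ord_recr /= mulrDr IHt !exprS -natr1; ring.
Qed.

Lemma power_sum4 (R : comNzRingType) (Q : R) (t : nat) :
  let v := (Q - 1) * t%:R in
  let g2 := v * (v - 2%:R) + (Q + 1) in
  (Q - 1) ^+ 5 * (\sum_(k < t.+1) k%:R ^+ 4 * Q ^+ k) =
  Q ^+ t.+1 * (g2 * g2 + Q * (4%:R * v * (v - 2%:R - (Q + 1)) + (Q + 1) * (Q + 9%:R)))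
   - Q * (Q + 1) * (Q ^+ 2 + 10%:R * Q + 1).
Proof.
elim: t => [|t /= IHt]; first by rewrite big_ord1 /=; ring.
rewrite big_ord_recr /= mulrDr IHt !exprS -natr1; ring.
Qed.

End PowerSumIdentities.

Definition power_sum (j K Q : nat) : nat := \sum_(k < K) k ^ j * Q ^ k.

Lemma power_sum0_div u K : 1 < u ->
  (u.+1 ^ K) %/ u = power_sum 0 K u.+1.
Proof.
move=> u1; have : 0 < u.+1 ^ K by rewrite expn_gt0.
move/prednK <-; rewrite predn_exp /= -addn1 mulnC divnMDl ?(ltnW u1) // divn_small // addn0.
by apply: eq_bigr => k _; rewrite mul1n.
Qed.

Lemma natr_power_sum (R : comNzRingType) j K Q :
  ((power_sum j K Q)%:R = \sum_(k < K) k%:R ^+ j * Q%:R ^+ k :> R)%R.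
Proof.
by rewrite /power_sum GRing.natr_sum; apply: eq_bigr => k _; rewrite GRing.natrM !GRing.natrX.
Qed.

(** With [Q = u + 1] the correction [Q * (Q + 1)] is below the divisor [u ^ 3], so
    it disappears in the floor. The argument [z] stands for the truncated
    difference [v - 2], which is exact here. *)
Lemma power_sum2_div u t z : 4 <= u -> z.+2 = u * t.+1 ->
  (u.+1 ^ t.+2 * (u * t.+1 * z + u.+2)) %/ u ^ 3 = power_sum 2 t.+2 u.+1.
Proof.
move=> u4 zE.
have -> : u.+1 ^ t.+2 * (u * t.+1 * z + u.+2) =
   power_sum 2 t.+2 u.+1 * u ^ 3 + u.+1 * u.+2.
  apply/eqP; rewrite -(Num.Theory.eqr_nat int).
  rewrite !(GRing.natrD, GRing.natrM, GRing.natrX) natr_power_sum.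
  have := @power_sum2 int u.+1%:R t.+1; rewrite /= [(_ - 1)%R](_ : _ = u%:R)%R; last by lia.
  rewrite GRing.mulrC => ->.
  have -> : (z%:R = u%:R * t.+1%:R - 2%:R :> int)%R by lia.
  apply/eqP; rewrite -!GRing.natr1; ring.
rewrite divnMDl ?expn_gt0 ?(leq_trans _ u4) // divn_small ?addn0 //; nia.
Qed.

(** As for the squares; the correction now has degree 4 in [Q], and [32 <= u] puts
    it below [u ^ 5]. *)
Lemma power_sum4_div u t z y : 32 <= u -> z.+2 = u * t.+1 -> z = y + u.+2 ->
  let g2 := u * t.+1 * z + u.+2 in
  (u.+1 ^ t.+2 *
     (g2 * g2 + u.+1 * (4 * (u * t.+1) * y + u.+2 * (u.+1 + 9)))) %/ u ^ 5
  = power_sum 4 t.+2 u.+1.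
Proof.
move=> u4 zE yE g2.
have -> : u.+1 ^ t.+2 *
     (g2 * g2 + u.+1 * (4 * (u * t.+1) * y + u.+2 * (u.+1 + 9))) =
   power_sum 4 t.+2 u.+1 * u ^ 5 + u.+1 * u.+2 * (u.+1 ^ 2 + 10 * u.+1 + 1).
  rewrite {}/g2.
  apply/eqP; rewrite -(Num.Theory.eqr_nat int).
  rewrite !(GRing.natrD, GRing.natrM, GRing.natrX) natr_power_sum.
  have := @power_sum4 int u.+1%:R t.+1; rewrite /= [(_ - 1)%R](_ : _ = u%:R)%R; last by lia.
  rewrite GRing.mulrC => ->.
  have -> : (y%:R = z%:R - (u%:R + 2%:R) :> int)%R by lia.
  have -> : (z%:R = u%:R * t.+1%:R - 2%:R :> int)%R by lia.
  apply/eqP; rewrite -!GRing.natr1; ring.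
rewrite divnMDl ?expn_gt0 ?(leq_trans _ u4) // divn_small ?addn0 //; nia.
Qed.

Definition supplies (oZ : option nat) (Z : nat) : Prop :=
  if oZ is Some Z' then Z' = Z else True.

Lemma output_power_if_needed Q K oZ :
  supplies oZ (Q ^ K) -> output (power_if_needed Q K oZ) = Q ^ K.
Proof. by case: oZ. Qed.

Lemma output_G02 Q K oZ : 2 <= K -> 5 <= Q -> supplies oZ (Q ^ K) ->
  output (G02 Q K (K - 1) oZ) = (power_sum 0 K Q, power_sum 2 K Q).
Proof.
case: K => [|[|t]] // _; case: Q => // u u4 oZP.
rewrite /= output_power_if_needed // !subn1 !addn1 /=.
rewrite power_sum0_div ?power_sum2_div //; nia.
Qed.

Lemma output_G024 Q K oZ : 3 <= K -> 33 <= Q -> supplies oZ (Q ^ K) ->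
  output (G024 Q K (K - 1) oZ) =
    (power_sum 0 K Q, power_sum 2 K Q, power_sum 4 K Q).
Proof.
case: K => [|[|t]] // t1; case: Q => // u u32 oZP.
rewrite /= output_power_if_needed // !subn1 !addn1 /=.
have zE : (u * t.+1 - 2).+2 = u * t.+1 by rewrite -addn2 subnK; nia.
rewrite power_sum0_div ?power_sum2_div ?power_sum4_div //; nia.
Qed.

(** * The digits indexed by the grid *)

Definition grid_sum (K : nat) (f : nat -> nat -> nat) (A B : nat) : nat :=
  \sum_(x < K) \sum_(y < K) f x y * (A ^ x * B ^ y).

Lemma power_sumM i j K A B :
  power_sum i K A * power_sum j K B = grid_sum K (fun x y => x ^ i * y ^ j) A B.
Proof.
rewrite big_distrlr; apply: eq_bigr => x _; apply: eq_bigr => y _.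
exact: mulnACA.
Qed.

Lemma eq_grid_sum K f g A B :
  (forall x y, x < K -> y < K -> f x y = g x y) ->
  grid_sum K f A B = grid_sum K g A B.
Proof. by move=> fg; apply: eq_bigr => x _; apply: eq_bigr => y _; rewrite fg. Qed.

Lemma grid_sumD K f g A B :
  grid_sum K f A B + grid_sum K g A B = grid_sum K (fun x y => f x y + g x y) A B.
Proof.
rewrite -big_split; apply: eq_bigr => x _; rewrite -big_split.
by apply: eq_bigr => y _; rewrite mulnDl.
Qed.

Lemma grid_sumZ K c f A B :
  c * grid_sum K f A B = grid_sum K (fun x y => c * f x y) A B.
Proof.
rewrite big_distrr; apply: eq_bigr => x _ /=; rewrite big_distrr.
by apply: eq_bigr => y _ /=; rewrite mulnA.
Qed.

Lemma grid_sumB K f g A B :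
  (forall x y, x < K -> y < K -> g x y <= f x y) ->
  grid_sum K f A B - grid_sum K g A B = grid_sum K (fun x y => f x y - g x y) A B.
Proof.
move=> gf; apply/eqP; rewrite -(eqn_add2r (grid_sum K g A B)) grid_sumD subnK.
  by apply/eqP; apply: eq_grid_sum => x y xK yK; rewrite subnK ?gf.
by apply: leq_sum => x _; apply: leq_sum => y _; rewrite leq_mul2r gf ?orbT.
Qed.

(** As long as [x ^ 2 <= P + 2] this is [P + 2 - (x ^ 2 - d * y ^ 2)], hence [P + 1]
    exactly on the Pell conic. *)
Definition linear_digit (d P x y : nat) : nat := P + 2 - x ^ 2 + d * y ^ 2.

(** [P + 1 - (x ^ 2 - d * y ^ 2 - 1) ^ 2], written with the two truncated
    subtractions that [Tsub] performs. In the range where these are exact it is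
    [P + 1] on the Pell conic and at most [P] elsewhere. *)
Definition square_digit (d P x y : nat) : nat :=
  (P - x ^ 4 + 2 * (x ^ 2 * (1 + d * y ^ 2))) - (2 * (d * y ^ 2) + (d * y ^ 2) ^ 2).

Lemma output_Ssub d P Pm K A B : K ^ 2 <= P ->
  output (Ssub d P Pm (power_sum 0 K A, power_sum 2 K A)
                      (power_sum 0 K B, power_sum 2 K B)) =
    Pm * grid_sum K (linear_digit d P) A B.
Proof.
move=> KP /=; congr (Pm * _); rewrite mulnC mulnBl -mulnA.
rewrite [_ * (d * _)]mulnCA.
rewrite !power_sumM !grid_sumZ grid_sumB ?grid_sumD; last first.
  by move=> x y xK yK; nia.
by apply: eq_grid_sum => x y _ _; rewrite /linear_digit !mul1n !muln1.
Qed.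

(** Both [x ^ 2] and [d * y ^ 2 + 1] are at most [d * K ^ 2], hence so is their
    distance, whose square is then at most [P]. *)
Lemma square_digit_spec d P K x y : 0 < d -> d ^ 2 * K ^ 4 <= P -> x < K -> y < K ->
  [/\ x ^ 4 <= P,
   2 * (d * y ^ 2) + (d * y ^ 2) ^ 2 <= P - x ^ 4 + 2 * (x ^ 2 * (1 + d * y ^ 2)) &
   if x ^ 2 == d * y ^ 2 + 1 then square_digit d P x y = P + 1
   else 0 < square_digit d P x y <= P].
Proof.
move=> d0 KP xK yK; rewrite /square_digit.
have aK : x ^ 2 <= d * K ^ 2 by apply: leq_trans (leq_pmull _ d0); rewrite leq_exp2r // ltnW.
have bK : d * y ^ 2 + 1 <= d * K ^ 2.
  by apply: (@leq_trans (d * (y ^ 2 + 1))); [lia | rewrite leq_mul2l; nia].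
have -> : x ^ 4 = (x ^ 2) ^ 2 by rewrite -expnM.
have {}KP : (d * K ^ 2) ^ 2 <= P by rewrite expnMn -expnM.
move: (d * K ^ 2) (x ^ 2) (d * y ^ 2) aK bK KP => C a b aC bC CP.
have aP : a ^ 2 <= P by nia.
have [p pE] : exists p, P = p + a ^ 2 by exists (P - a ^ 2); lia.
rewrite pE addnK in CP *.
case: eqP => [->|ab]; first by split => //; nia.
have [k [kC kE]] : exists k, 0 < k <= C /\ (a = b + 1 + k \/ b + 1 = a + k).
  case: (leqP a (b + 1)) => ab1; first by exists (b + 1 - a); lia.
  by exists (a - (b + 1)); lia.
have kP : k ^ 2 <= p + a ^ 2 by nia.
split; first by lia.
  by case: kE => kE; nia.
by case: kE => kE; nia.
Qed.

Lemma output_Tsub d P Pm K A B : 0 < d -> d ^ 2 * K ^ 4 <= P ->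
  output (Tsub d P Pm (power_sum 0 K A, power_sum 2 K A, power_sum 4 K A)
                      (power_sum 0 K B, power_sum 2 K B, power_sum 4 K B)) =
    Pm * grid_sum K (square_digit d P) A B.
Proof.
move=> d0 KP /=; congr (Pm * _).
have -> : power_sum 0 K B * (P * power_sum 0 K A - power_sum 4 K A) =
   grid_sum K (fun x y => P - x ^ 4) A B.
  rewrite mulnC mulnBl -mulnA !power_sumM grid_sumZ grid_sumB; last first.
    by move=> x y xK yK; have [xP _ _] := square_digit_spec d0 KP xK yK; lia.
  by apply: eq_grid_sum => x y _ _; rewrite !muln1.
have -> : 2 * power_sum 2 K A * (power_sum 0 K B + d * power_sum 2 K B) =
   grid_sum K (fun x y => 2 * (x ^ 2 * (1 + d * y ^ 2))) A B.
  rewrite -mulnA mulnDr [_ * (d * _)]mulnCA !power_sumM !grid_sumZ grid_sumD grid_sumZ.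
  by apply: eq_grid_sum => x y _ _; ring.
have -> : power_sum 0 K A * (2 * (d * power_sum 2 K B) + d * d * power_sum 4 K B) =
   grid_sum K (fun x y => 2 * (d * y ^ 2) + (d * y ^ 2) ^ 2) A B.
  rewrite mulnDr [_ * (2 * _)]mulnCA [_ * (d * _)]mulnCA [_ * (d * d * _)]mulnCA.
  rewrite !power_sumM !grid_sumZ grid_sumD.
  by apply: eq_grid_sum => x y _ _; ring.
rewrite grid_sumD grid_sumB // => x y xK yK.
by have [] := square_digit_spec d0 KP xK yK.
Qed.

(** * Division by a power minus one *)

(** Since [Q ^ s = (Q - 1) * (1 + ... + Q ^ (s - 1)) + 1], dividing by [Q - 1]
    turns an exponent [s] into [s] repetitions of the coefficient, and leaves the
    sum of the coefficients as remainder. *)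
Lemma divn_sum_expn (I : finType) (c s : I -> nat) Q : 1 < Q ->
  (\sum_i c i * Q ^ s i) %/ (Q - 1) =
    \sum_i c i * (\sum_(j < s i) Q ^ j) + (\sum_i c i) %/ (Q - 1).
Proof.
move=> Q1; rewrite -divnMDl ?subn_gt0 //; congr (_ %/ _).
rewrite big_distrl -big_split /=; apply: eq_bigr => i _.
rewrite -mulnA -[X in _ + X]muln1 -mulnDr; congr (_ * _).
have : 0 < Q ^ s i by rewrite expn_gt0 ltnW.
by rewrite mulnC subn1 -predn_exp addn1 => /prednK.
Qed.

(** A digit [c i] standing [r i] places up in a block is repeated in [s i] blocks.
    The final 1 is for the remainder, which can equal the divisor. *)
Lemma HW_divn_sum (I : finType) (c r s : I -> nat) b :
  0 < b -> \sum_i c i * 2 ^ r i <= 2 ^ b - 1 ->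
  HW ((\sum_i (c i * 2 ^ r i) * (2 ^ b) ^ s i) %/ (2 ^ b - 1))
    <= \sum_i s i * HW (c i) + 1.
Proof.
move=> b0 le_b; have b1 : 1 < 2 ^ b by rewrite -[1](expn0 2) ltn_exp2l.
rewrite divn_sum_expn //; apply: leq_trans (HW_addn _ _) _; apply: leq_add; last first.
  apply: HW_leq_length; rewrite ltnS.
  by apply: leq_trans (leq_div2r _ le_b) _; rewrite divnn leq_b1.
apply: leq_trans (HW_sum _ _ _) _; apply: leq_sum => i _.
rewrite big_distrr; apply: leq_trans (HW_sum _ _ _) _.
under eq_bigr => j _ do rewrite -expnM HW_shift HW_shift.
by rewrite sum_nat_const card_ord.
Qed.

Lemma leq_divn_sum (I : finType) (c s : I -> nat) Q i : 1 < Q -> 0 < s i ->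
  c i <= (\sum_i c i * Q ^ s i) %/ (Q - 1).
Proof.
move=> Q1 si; rewrite divn_sum_expn //; apply: leq_trans (leq_addr _ _).
rewrite (bigD1 i) //=; apply: leq_trans (leq_addr _ _); apply: leq_pmulr.
by case: (s i) si => // j _; rewrite big_ord_recl.
Qed.

(** * Solutions of the Pell equation below a bound *)

(** Dividing the larger solution by the smaller one in the ring of numbers
    [x + y * sqrt d] gives a third solution [(h, g)] with [g > 0], so that
    [x' = x * h + d * y * g]. Here [h >= 2], and [d * y >= x]. *)
Lemma pell_pairs_gap d x y x' y' : 1 < d -> 0 < y ->
  x ^ 2 = d * y ^ 2 + 1 -> x' ^ 2 = d * y' ^ 2 + 1 -> x < x' -> 3 * x <= x'.
Proof.
move=> d1 y0 xE xE' xx'.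
have b2 : 1 < d * y ^ 2 by rewrite (leq_trans d1) // leq_pmulr // expn_gt0 y0.
have yy' : y < y'.
  rewrite -(ltn_exp2r _ _ (isT : 0 < 2)) -(ltn_pmul2l (ltnW d1)).
  by have := xx'; rewrite -(ltn_exp2r _ _ (isT : 0 < 2)) xE xE' ltn_add2r.
have x2 : 1 < x by rewrite -(ltn_exp2r _ _ (isT : 0 < 2)) xE; lia.
have [g [g0 gE]] : exists g, 0 < g /\ x * y' = x' * y + g.
  have : x' * y < x * y'.
    rewrite -(ltn_exp2r _ _ (isT : 0 < 2)) !expnMn xE xE'.
    by rewrite !mulnDl mulnAC ltn_add2l !mul1n ltn_exp2r.
  by move=> lt; exists (x * y' - x' * y); lia.
have [h [h0 hE]] : exists h, 0 < h /\ x * x' = d * y * y' + h.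
  have : d * y * y' < x * x'.
    rewrite -(ltn_exp2r _ _ (isT : 0 < 2)) [(x * _) ^ _]expnMn xE xE'.
    have -> : (d * y * y') ^ 2 = (d * y ^ 2) * (d * y' ^ 2) by ring.
    by rewrite mulnDl mulnDr; lia.
  by move=> lt; exists (x * x' - d * y * y'); lia.
have x'E : x' = x * h + d * y * g.
  have e1 : x * (x * x') = d * y * (x * y') + x * h by rewrite hE; ring.
  have : (d * y ^ 2 + 1) * x' = d * y * (x' * y + g) + x * h.
    by rewrite -xE -gE -e1; ring.
  by rewrite !(mulnDl, mulnDr, mulnA) mul1n; lia.
have h2 : 1 < h.
  have : h ^ 2 = d * g ^ 2 + 1.
    have hZ : (h%:R = x%:R * x'%:R - d%:R * y%:R * y'%:R :> int)%R by lia.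
    have gZ : (g%:R = x%:R * y'%:R - x'%:R * y%:R :> int)%R by lia.
    have eZ : (x%:R ^+ 2 = d%:R * y%:R ^+ 2 + 1 :> int)%R by lia.
    have eZ' : (x'%:R ^+ 2 = d%:R * y'%:R ^+ 2 + 1 :> int)%R by lia.
    apply/eqP; rewrite -(Num.Theory.eqr_nat int).
    rewrite !(GRing.natrD, GRing.natrM, GRing.natrX) hZ gZ; apply/eqP.
    transitivity (x%:R ^+ 2 * x'%:R ^+ 2 - d%:R * y%:R ^+ 2 * x'%:R ^+ 2
      - d%:R * y'%:R ^+ 2 * x%:R ^+ 2 + (d%:R * y%:R ^+ 2) * (d%:R * y'%:R ^+ 2)
      + d%:R * (x%:R * y'%:R - x'%:R * y%:R) ^+ 2 : int)%R; first by ring.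
    by rewrite eZ eZ'; ring.
  move=> hE2; rewrite -(ltn_exp2r _ _ (isT : 0 < 2)) hE2.
  have : 2 * 1 <= d * g ^ 2 by rewrite leq_mul // expn_gt0 g0.
  by lia.
have dyx : x <= d * y.
  rewrite -(leq_exp2r _ _ (isT : 0 < 2)) xE.
  have -> : (d * y) ^ 2 = d * (d * y ^ 2) by ring.
  by apply: leq_trans (leq_mul d1 (leqnn _)); lia.
have : x * 2 <= x * h by rewrite leq_mul2l h2 orbT.
by have : d * y * 1 <= d * y * g by [rewrite leq_mul2l g0 orbT]; lia.
Qed.

(** If [n] belongs to [Q] then all smaller elements are at most [n %/ 3], so the
    sum is dominated by a geometric series of ratio 3. *)
Lemma sum_sparse (Q : pred nat) n :
  (forall x x', x < x' <= n -> Q x -> Q x' -> 3 * x <= x') ->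
  2 * \sum_(x < n.+1 | Q x) x <= 3 * n.
Proof.
have [m] := ubnP n; elim: m n => // m IHm n nm sparse.
rewrite big_mkcond big_ord_recr -big_mkcond /=.
case: ifP => Qn; last first.
  case: n nm sparse Qn => [|n] nm sparse Qn; first by rewrite big_ord0.
  have := IHm n ltac:(lia) _.
  rewrite addn0 => le; apply: leq_trans (le _) _; last by lia.
  by move=> x x' lt; apply: sparse; lia.
have [->|n0] := posnP n; first by rewrite big_ord0.
have h_lt : (n %/ 3).+1 <= n by lia.
have -> : \sum_(x < n | Q x) x = \sum_(x < (n %/ 3).+1 | Q x) x.
  rewrite -!(big_mkord Q id) (big_cat_nat (leq0n _) h_lt) /= -[RHS]addn0; congr (_ + _).
  rewrite big_nat_cond big1 // => x /andP[/andP[lx xn] Qx].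
  by have := sparse x n ltac:(lia) Qx Qn; lia.
have := IHm (n %/ 3) ltac:(lia) _.
rewrite mulnDr => le; have : 2 * \sum_(x < (n %/ 3).+1 | Q x) x <= 3 * (n %/ 3).
  by apply: le => x x' lt; apply: sparse; lia.
by lia.
Qed.

Definition on_pell (d x y : nat) : bool := x ^ 2 == d * y ^ 2 + 1.

(** The solution [(1, 0)] has to be counted apart, since the next abscissa may be
    2; the others triple at each step. *)
Lemma sum_pell_x d K : 1 < d -> 0 < K ->
  2 * \sum_(x < K) \sum_(y < K) x * on_pell d x y <= 3 * K - 1.
Proof.
case: K => // K d1 _.
pose Q x := [exists y : 'I_K.+1, (0 < y) && on_pell d x y].
have le x : \sum_(y < K.+1) x * on_pell d x y <= (x == 1) + (if Q x then x else 0).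
  have [y0 /= y0E|none] := pickP (fun y : 'I_K.+1 => on_pell d x y); last first.
    by rewrite big1 // => y _; rewrite [on_pell _ _ _]none muln0.
  rewrite (bigD1 y0) //= y0E muln1 big1 => [|y yy0]; last first.
    have [yE|] := boolP (on_pell d x y); last by rewrite muln0.
    case/eqP: yy0; apply: val_inj => /=; move: (y0E) yE.
    rewrite /on_pell => /eqP-> /eqP; rewrite !addn1 => -[] /eqP.
    by rewrite eqn_pmul2l ?(ltnW d1) // eqn_exp2r // => /eqP.
  have [y00|y00] := posnP y0.
    move: y0E; rewrite y00 /on_pell muln0 add0n; case: x => [|[|x]] //=; nia.
  suff -> : Q x by rewrite addn0 leq_addl.
  by apply/existsP; exists y0; rewrite y00.
apply: (@leq_trans (2 * (1 + \sum_(x < K.+1 | Q x) x))).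
  rewrite leq_mul2l /=; apply: (@leq_trans
    (\sum_(x < K.+1) ((x == 1 :> nat) + (if Q x then val x else 0)))).
    by apply: leq_sum => x _; apply: le.
  rewrite big_split; apply: leq_add; last by rewrite -big_mkcond.
  case: K {Q le} => [|K]; first by rewrite big_ord1.
  rewrite (bigD1 (Ordinal (isT : 1 < K.+2))) //= big1 // => x x1.
  by case: eqP => // e; case/eqP: x1; apply: val_inj.
have := @sum_sparse Q K _.
rewrite mulnDr => le2; have : 2 * \sum_(x < K.+1 | Q x) x <= 3 * K; last by lia.
apply: le2 => x x' /andP[xx' _] /existsP[y /andP[y0 /eqP yE]] /existsP[y' /andP[_ /eqP yE']].
exact: pell_pairs_gap yE yE' xx'.
Qed.

Lemma sum_pell_y d K : 1 < d -> 0 < K ->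
  2 * \sum_(x < K) \sum_(y < K) y * on_pell d x y <= 3 * K - 1.
Proof.
move=> d1 K0; apply: leq_trans (sum_pell_x d1 K0); rewrite leq_mul2l /=.
apply: leq_sum => x _; apply: leq_sum => y _.
rewrite /on_pell; case: eqP => [e|]; rewrite ?muln0 // !muln1.
by rewrite -(leq_exp2r _ _ (isT : 0 < 2)); nia.
Qed.

Lemma sum_ord_id K : 2 * \sum_(x < K) x = K * (K - 1).
Proof.
elim: K => [|K IHK]; first by rewrite big_ord0.
by rewrite big_ord_recr mulnDr IHK /=; nia.
Qed.

(** * The weight of the quotient *)

(** The conditions on the digits [(2 ^ w - 1) * n x y] in base [2 ^ k] under which
    the weight of [M] reveals the Pell solutions: about [w] ones for each digit,
    and [w] more on the conic. The error [E] is zero for the squared digits. *)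
Definition weighted_digits (d K w E k : nat) (n : nat -> nat -> nat) : Prop :=
  forall x y, x < K -> y < K ->
  [/\ 0 < n x y, (2 ^ w - 1) * n x y <= 2 ^ k - 1 &
      HW ((2 ^ w - 1) * n x y) <= w + E + w * on_pell d x y].

Lemma square_digits_weighted d K w : 0 < d -> d ^ 2 * K ^ 4 <= 2 ^ w ->
  weighted_digits d K w 0 (2 * w) (square_digit d (2 ^ w)).
Proof.
move=> d0 KP x y xK yK; have [_ _] := square_digit_spec d0 KP xK yK.
have P0 : 0 < 2 ^ w by rewrite expn_gt0.
have PP : 2 ^ (2 * w) = 2 ^ w * 2 ^ w by rewrite mul2n -addnn expnD.
rewrite /on_pell; case: eqP => _ /= => [->|/andP[n0 nP]].
  rewrite addn0 muln1 addn1; split => //; first by rewrite PP; nia.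
  by apply: HW_leq_length; rewrite expnD; nia.
split => //; first by rewrite PP; nia.
by rewrite muln0 !addn0; apply: HW_mul_ones; rewrite n0.
Qed.

Lemma quartic_leq_exp2 K : 64 <= K -> 2 * K ^ 4 <= 2 ^ K.
Proof.
(* The exponent 6 is kept abstract so that [2 ^ 2 ^ 6] is never computed. *)
have [a aE] : exists a, a = 6 by exists 6.
have -> : 64 = 2 ^ a by rewrite aE.
move=> /subnK <-; elim: (K - 2 ^ a) => [|j IHj].
  by rewrite add0n -expnM -expnS leq_exp2l // aE.
rewrite addSn [leqRHS]expnS; apply: leq_trans (leq_mul (leqnn 2) IHj).
have : 64 <= j + 2 ^ a by rewrite aE leq_addl.
by move: (j + 2 ^ a) => L L64; nia.
Qed.

(** The difference [n x y - (2 ^ w + 1)] is at most [d * K ^ 2 + 1 <= 2 ^ K], and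
    only its binary length counts in the error term. *)
Lemma linear_digits_weighted d K w : d <= K ^ 2 -> 64 <= K -> 2 * K <= w ->
  weighted_digits d K w K.+1 (3 * w) (linear_digit d (2 ^ w)).
Proof.
move=> dK K64 Kw x y xK yK.
have K4 := quartic_leq_exp2 K64.
have KP : 2 ^ K * 2 ^ K <= 2 ^ w by rewrite -expnD addnn -mul2n leq_exp2l.
have PPP : 2 ^ (3 * w) = 2 ^ w * 2 ^ w * 2 ^ w by rewrite mulnC expnM !expnS expn0; ring.
have dyK : d * y ^ 2 + 2 <= 2 ^ K.
  have : d * y ^ 2 <= K ^ 4 by rewrite (expnD K 2 2) leq_mul // leq_exp2r // ltnW.
  have : 1 <= K ^ 4 by rewrite expn_gt0; lia.
  lia.
have xK2 : x ^ 2 <= K ^ 2 by rewrite leq_exp2r // ltnW.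
have K24 : K ^ 2 <= K ^ 4 by rewrite leq_exp2l //; lia.
have P0 : 0 < 2 ^ K by rewrite expn_gt0.
rewrite /linear_digit; set n := _ + d * y ^ 2.
have nE : n + x ^ 2 = 2 ^ w + 2 + d * y ^ 2 by rewrite /n; nia.
have n0 : 0 < n by nia.
have nP : n <= 2 * 2 ^ w by nia.
split => //; first by rewrite PPP; move: (2 ^ w) nP n0 KP P0 => P; nia.
rewrite /on_pell; case: eqP => /= [xE|xE].
  have -> : n = 2 ^ w + 1 by lia.
  apply: (@leq_trans (w + w)); last by lia.
  by apply: HW_leq_length; rewrite expnD; nia.
have [nw|nw] := leqP n (2 ^ w).
  by apply: leq_trans (HW_mul_ones _) _; rewrite ?n0 //; lia.
have [m mE] : exists m, n = 2 ^ w + 1 + m by exists (n - (2 ^ w + 1)); lia.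
rewrite muln0 addn0 mE; apply: HW_mul_ones_over; nia.
Qed.

Lemma sum_geometric Q K : 0 < Q -> (\sum_(x < K) Q ^ x) * (Q - 1) = Q ^ K - 1.
Proof. by move=> Q0; rewrite mulnC !subn1 predn_exp. Qed.

(** The exponents [K * x + y] run through all numbers below [K * K]. *)
Lemma sum_grid_geometric K q : 0 < q ->
  (\sum_(x < K) \sum_(y < K) q ^ (K * x + y)) * (q - 1) = q ^ (K * K) - 1.
Proof.
move=> q0.
have -> : \sum_(x < K) \sum_(y < K) q ^ (K * x + y) =
   (\sum_(x < K) (q ^ K) ^ x) * (\sum_(y < K) q ^ y).
  rewrite big_distrlr; apply: eq_bigr => x _; apply: eq_bigr => y _ /=.
  by rewrite expnD expnM.
by rewrite -mulnA sum_geometric // sum_geometric ?expn_gt0 ?q0 // expnM.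
Qed.

Lemma sum_weights K s1 s2 :
  2 * \sum_(p : 'I_K * 'I_K) (s1 * p.1 + s2 * p.2) = (s1 + s2) * (K * K * (K - 1)).
Proof.
rewrite -(pair_bigA _ (fun x y : 'I_K => s1 * x + s2 * y)) /=.
transitivity (2 * ((s1 + s2) * (K * \sum_(x < K) x))).
  congr (2 * _); transitivity (\sum_(x < K) (K * s1 * x + s2 * \sum_(y < K) y)).
    apply: eq_bigr => x _; rewrite big_split /= sum_nat_const card_ord mulnA.
    by rewrite big_distrr.
  by rewrite big_split /= sum_nat_const card_ord -big_distrr /=; ring.
by rewrite mulnCA [2 * (K * _)]mulnCA sum_ord_id [K * (K * _)]mulnA.
Qed.

Lemma sum_pell_weights d K s1 s2 : 1 < d -> 0 < K ->
  2 * \sum_(p : 'I_K * 'I_K) (s1 * p.1 + s2 * p.2) * on_pell d p.1 p.2 <=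
    (s1 + s2) * (3 * K - 1).
Proof.
move=> d1 K0.
rewrite -(pair_bigA _ (fun x y : 'I_K => (s1 * x + s2 * y) * on_pell d x y)) /=.
have -> : \sum_(x < K) \sum_(y < K) (s1 * x + s2 * y) * on_pell d x y =
   s1 * (\sum_(x < K) \sum_(y < K) x * on_pell d x y) +
   s2 * (\sum_(x < K) \sum_(y < K) y * on_pell d x y).
  rewrite !big_distrr -big_split /=; apply: eq_bigr => x _.
  rewrite !big_distrr -big_split /=; apply: eq_bigr => y _.
  by rewrite mulnDl !mulnA.
have := sum_pell_x d1 K0; have := sum_pell_y d1 K0.
by set SX := \sum_(_ < _) _; set SY := \sum_(_ < _) _; nia.
Qed.

(** A point [(x, y)] contributes its digit, shifted, [s = s1 * x + s2 * y] times to
    [M]. The points of the grid account for [w * (s1 + s2) * (K * K * (K - 1) / 2)]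
    ones. By [sum_pell_weights] the Pell points add at most
    [w * (s1 + s2) * (3 * K - 1) / 2], and the error terms at most half of
    [w * (s1 + s2) * K]: together at most [w * (s1 + s2) * (2 * K - 1 / 2)]. The half
    left over exceeds the 1 of [HW_divn_sum]. Conversely the last digit alone lies
    [k * (K * K - 1)] places up, so [M] is far larger than the parameter.

    The cases [(r1, r2) = (K, 1)] and [(1, K)] are the two orders in which the
    points can be listed, and [s1], [s2] tell which coordinate repeats a digit:
    [(1, 2 * K)] encodes both coordinates in a single sum. *)
Lemma hw_window d K w E k n r1 r2 s1 s2 :
  1 < d -> 2 < K -> 2 < w -> 2 * w <= k -> K ^ 4 <= 2 ^ w ->
  weighted_digits d K w E k n -> E * (K * K * (K - 1)) <= w * K ->
  r1 = K /\ r2 = 1 \/ r1 = 1 /\ r2 = K ->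
  0 < s1 + s2 <= 2 * K + 1 ->
  let q := 2 ^ k in
  let M := ((2 ^ w - 1) * grid_sum K n (q ^ (r1 + K * K * s1)) (q ^ (r2 + K * K * s2)))
     %/ (q ^ (K * K) - 1) in
  HW M < w * (s1 + s2) * (K * K * (K - 1) %/ 2 + 2 * K) <= 2 * M.
Proof.
move=> d1 K2 w2 wk KP digits EK rK cK; cbv zeta; set q := 2 ^ k.
set D := fun x y => (2 ^ w - 1) * n x y.
set rho := fun x y => r1 * x + r2 * y; set s := fun x y => s1 * x + s2 * y.
have q1 : 1 < q by rewrite -[1](expn0 2) ltn_exp2l //; lia.
have -> : (2 ^ w - 1) * grid_sum K n (q ^ (r1 + K * K * s1)) (q ^ (r2 + K * K * s2)) =
  \sum_(p : 'I_K * 'I_K) D p.1 p.2 * 2 ^ (k * rho p.1 p.2) *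
      (2 ^ (k * (K * K))) ^ (s p.1 p.2).
  rewrite grid_sumZ /grid_sum pair_bigA; apply: eq_bigr => -[x y] _ /=.
  rewrite -[RHS]mulnA; congr (_ * _); rewrite /q -!expnM -!expnD; congr (2 ^ _).
  by rewrite /rho /s; ring.
rewrite (_ : q ^ (K * K) = 2 ^ (k * (K * K))); last by rewrite /q -expnM.
have rho_sum : (\sum_(p : 'I_K * 'I_K) 2 ^ (k * rho p.1 p.2)) * (q - 1) =
    2 ^ (k * (K * K)) - 1.
  rewrite expnM -sum_grid_geometric ?(ltnW q1) //; congr (_ * _).
  rewrite -(pair_bigA _ (fun x y : 'I_K => 2 ^ (k * rho x y))) /= /rho.
  case: rK => -[-> ->]; last rewrite exchange_big.
    by apply: eq_bigr => x _; apply: eq_bigr => y _; rewrite expnM mul1n.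
  by apply: eq_bigr => x _; apply: eq_bigr => y _; rewrite expnM mul1n addnC.
have le_b : \sum_(p : 'I_K * 'I_K) D p.1 p.2 * 2 ^ (k * rho p.1 p.2) <=
    2 ^ (k * (K * K)) - 1.
  rewrite -rho_sum big_distrl /=; apply: leq_sum => -[x y] _ /=.
  by rewrite mulnC leq_mul2l; have [_ -> _] := digits x y (ltn_ord _) (ltn_ord _); rewrite orbT.
apply/andP; split.
  have b0 : 0 < k * (K * K) by nia.
  have leHW := HW_divn_sum (fun p : 'I_K * 'I_K => s p.1 p.2) b0 le_b.
  apply: leq_ltn_trans leHW _.
  have : \sum_(p : 'I_K * 'I_K) s p.1 p.2 * HW (D p.1 p.2) <=
     (w + E) * \sum_(p : 'I_K * 'I_K) s p.1 p.2 +
     w * \sum_(p : 'I_K * 'I_K) s p.1 p.2 * on_pell d p.1 p.2.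
    rewrite !big_distrr -big_split /=; apply: leq_sum => -[x y] _ /=.
    have [_ _ le] := digits x y (ltn_ord _) (ltn_ord _).
    by apply: leq_trans (leq_mul (leqnn _) le) _; nia.
  have := sum_weights K s1 s2; have := sum_pell_weights s1 s2 d1 (ltnW (ltnW K2)).
  set H := \sum_p _; set S' := \sum_p _; set S := \sum_p _.
  have : K * K * (K - 1) = 2 * ((K * K * (K - 1)) %/ 2).
    by have := sum_ord_id K; move: (\sum_(x < K) x) => T TE; rewrite -mulnA -TE mulnCA mulKn.
  move: {D rho s digits le_b rho_sum} S S' H (K * K * (K - 1)) (_ %/ 2) EK cK.
  move=> S S' H V sg EK /andP[c0 _]; move: (s1 + s2) c0 => c c0.
  move=> VE S'E SE HE.
  have : w * (2 * S') <= w * (c * (3 * K - 1)) by rewrite leq_mul2l S'E orbT.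
  have : (w + E) * (2 * S) = w * (c * V) + c * (E * V) by rewrite SE; ring.
  have : c * (E * V) <= c * (w * K) by rewrite leq_mul2l EK orbT.
  rewrite -(ltn_pmul2l (isT : 0 < 2)) => e1 e2 e3.
  have -> : 2 * (w * c * (sg + 2 * K)) = w * (c * V) + c * (w * K) + w * (c * (3 * K - 1)) + w * c.
    rewrite VE; case: (K) K2 => // K' _; rewrite mulnBr; nia.
  have : 2 < w * c by nia.
  by nia.
have lastK : K.-1 < K by lia.
pose p := (Ordinal lastK, Ordinal lastK).
have s0 : 0 < s K.-1 K.-1 by rewrite /s; nia.
have Q1 : 1 < 2 ^ (k * (K * K)) by rewrite -[1](expn0 2) ltn_exp2l //; nia.
apply: (@leq_trans (2 * (D K.-1 K.-1 * 2 ^ (k * rho K.-1 K.-1)))); last first.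
  rewrite leq_mul2l; apply/orP; right.
  exact: (@leq_divn_sum _ (fun p : 'I_K * 'I_K => D p.1 p.2 * 2 ^ (k * rho p.1 p.2))
     (fun p => s p.1 p.2) _ p Q1 s0).
have D0 : 0 < D K.-1 K.-1.
  have [n0 _ _] := digits _ _ lastK lastK; rewrite muln_gt0 n0 andbT subn_gt0.
  by rewrite -[1](expn0 2) ltn_exp2l //; lia.
(* The parameter is below [2 ^ (3 * w)]: its three factors are at most [2 ^ w],
   two of them because [K ^ 4 <= 2 ^ w]. *)
apply: (@leq_trans (2 ^ (3 * w))); last first.
  apply: (@leq_trans (2 ^ (k * rho K.-1 K.-1))).
    rewrite leq_exp2l //; apply: (@leq_trans (k * 2)); first by lia.
    by rewrite leq_mul2l /rho; apply/orP; right; case: rK => -[-> ->]; nia.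
  by rewrite -[leqLHS]mul1n mulnA leq_mul2r muln_gt0 D0 orbT.
have -> : 2 ^ (3 * w) = 2 ^ w * (2 ^ w * 2 ^ w).
  by rewrite -!expnD; congr (2 ^ _); lia.
rewrite -mulnA; apply: leq_mul; first exact: ltnW (ltn_expl _ _).
apply: leq_trans (leq_mul KP KP); case/andP: cK => _ cK.
have c_le : s1 + s2 <= K ^ 4 by apply: leq_trans cK _; nia.
apply: leq_mul => //; have := leq_trunc_div (K * K * (K - 1)) 2; nia.
Qed.

(** * The Hamming-weight calls of the programs *)

Lemma leq_expn_pos q j : 0 < q -> 0 < j -> q <= q ^ j.
Proof. by move=> q0 j0; rewrite -[leqLHS]expn1 leq_pexp2l. Qed.

(** A solution with positive coordinates forces [d < X ^ 2], so that [X < K] bounds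
    [d] by [K ^ 2]. *)
Lemma pell_bounds d X Y : 1 < d -> pell d X Y -> 1 < X /\ d < X ^ 2.
Proof.
move=> d1 [_ Y0 XE]; have dY : d <= d * Y ^ 2 by rewrite leq_pmulr // expn_gt0 Y0.
by split; last lia; rewrite -(ltn_exp2r _ _ (isT : 0 < 2)) XE; lia.
Qed.

(** The argument [M] of the Hamming-weight call, and [M_x] for [QT]. *)
Definition hw_argument (v : variant) (d K w : nat) : nat :=
  let P := 2 ^ w in
  let q := (if v is (SC | SO) then P ^ 3 else P * P) in
  let q1 := q ^ K in let q2 := q1 ^ K in let q3 := q2 ^ K in
  let t := K - 1 in
  match v with
  | SC => output (Ssub d P (P - 1) (output (G02 (q1 * q2) K t None))
                   (output (G02 (q * (q3 * q3)) K t None)))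
  | QC => output (Tsub d P (P - 1) (output (G024 (q1 * q2) K t None))
                   (output (G024 (q * (q3 * q3)) K t None)))
  | SO => output (Ssub d P (P - 1) (output (G02 (q1 * q2) K t None))
                   (output (G02 q K t (Some q1))))
  | _ => output (Tsub d P (P - 1) (output (G024 (q1 * q2) K t None))
                   (output (G024 q K t (Some q1))))
  end %/ (q2 - 1).

(** The argument [M_y], where the roles of the two series are exchanged. *)
Definition hw_argument_y (d K w : nat) : nat :=
  let P := 2 ^ w in
  let q := P * P in
  let q1 := q ^ K in let q2 := q1 ^ K in let t := K - 1 in
  output (Tsub d P (P - 1) (output (G024 q K t (Some q1)))
                   (output (G024 (q1 * q2) K t None))) %/ (q2 - 1).

Lemma hw_calls_let A x (k : nat -> run A) :
  hw_calls (bind (calc x) k) = hw_calls (k (Defs.eval x)).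
Proof. by []. Qed.

Lemma hw_calls_call A B (c : run A) (k : A -> run B) :
  hw_calls c = [::] -> hw_calls (bind c k) = hw_calls (k (output c)).
Proof. by move=> /= ->. Qed.

Lemma hw_calls_G02 Q K t oZ : hw_calls (G02 Q K t oZ) = [::].
Proof. by case: oZ. Qed.

Lemma hw_calls_G024 Q K t oZ : hw_calls (G024 Q K t oZ) = [::].
Proof. by case: oZ. Qed.

Lemma hw_calls_Ssub d P Pm U V : hw_calls (Ssub d P Pm U V) = [::].
Proof. by case: U V => ? ? []. Qed.

Lemma hw_calls_Tsub d P Pm U V : hw_calls (Tsub d P Pm U V) = [::].
Proof. by case: U V => -[? ?] ? [[]]. Qed.

Lemma hw_calls_Hsub A m e (k : nat -> run A) :
  hw_calls (bind (Hsub m e) k) = (m, e) :: hw_calls (k (output (Hsub m e))).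
Proof. by []. Qed.

Lemma hw_calls_Rsub d A B : hw_calls (Rsub d A B) = [::].
Proof. by []. Qed.

Lemma hw_calls_decode_C d K w sigma HM : hw_calls (decode_C d K w sigma HM) = [::].
Proof. by []. Qed.

Lemma hw_calls_decode_O d K w sigma q1 q2 HM :
  hw_calls (decode_O d K w sigma q1 q2 HM) = [::].
Proof. by []. Qed.

Ltac compute_hw_calls :=
  rewrite !(hw_calls_let, hw_calls_call _ (hw_calls_G02 _ _ _ _),
    hw_calls_call _ (hw_calls_G024 _ _ _ _),
    hw_calls_call _ (hw_calls_Ssub _ _ _ _ _),
    hw_calls_call _ (hw_calls_Tsub _ _ _ _ _), hw_calls_Hsub).

Lemma hw_calls_program v d K w :
  let e := Defs.eval (hw_choice v K w (K * K * (K - 1) %/ 2)) in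
  hw_calls (program v d K w) =
    (hw_argument v d K w, e) ::
      (if v is QT then [:: (hw_argument_y d K w, e)] else [::]).
Proof.
move=> e; rewrite /e {e}; case: v; rewrite /program.
- by rewrite /program_SC; compute_hw_calls; rewrite hw_calls_decode_C.
- by rewrite /program_SO; compute_hw_calls; rewrite hw_calls_decode_O.
- by rewrite /program_QC; compute_hw_calls; rewrite hw_calls_decode_C.
- by rewrite /program_QO; compute_hw_calls; rewrite hw_calls_decode_O.
by rewrite /program_QT; compute_hw_calls; rewrite hw_calls_Rsub.
Qed.

(** The error [E = K + 1] of each digit is absorbed as soon as [w >= 8 * K ^ 3]. *)
Lemma linear_window d K w s1 s2 A B oA oB :
  1 < d -> d <= K ^ 2 -> 64 <= K -> 8 * K ^ 3 <= w ->
  0 < s1 + s2 <= 2 * K + 1 ->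
  let q := (2 ^ w) ^ 3 in
  A = q ^ (K + K * K * s1) -> B = q ^ (1 + K * K * s2) ->
  supplies oA (A ^ K) -> supplies oB (B ^ K) ->
  let m := output (Ssub d (2 ^ w) (2 ^ w - 1) (output (G02 A K (K - 1) oA))
                   (output (G02 B K (K - 1) oB))) %/ ((q ^ K) ^ K - 1) in
  HW m < w * (s1 + s2) * (K * K * (K - 1) %/ 2 + 2 * K) <= 2 * m.
Proof.
move=> d1 dK K64 Kw sK; cbv zeta; set q := _ ^ 3 => AE BE oAE oBE.
have Kw2 : 2 * K <= w by apply: leq_trans Kw; rewrite !expnS; nia.
have KP : K ^ 4 <= 2 ^ w.
  apply: leq_trans (_ : 2 ^ K <= _); last by rewrite leq_exp2l //; lia.
  by apply: leq_trans (quartic_leq_exp2 K64); lia.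
have qE : q = 2 ^ (3 * w) by rewrite /q -expnM mulnC.
have q33 : 33 <= q by rewrite qE; apply: (@leq_trans (2 ^ 6)) => //; rewrite leq_exp2l //; lia.
have q0 : 0 < q by apply: leq_trans q33.
have A33 : 33 <= A by rewrite AE; apply: leq_trans q33 _; apply: leq_expn_pos => //; lia.
have B33 : 33 <= B by rewrite BE; apply: leq_trans q33 _; apply: leq_expn_pos => //; lia.
rewrite !output_G02 //; try lia.
rewrite output_Ssub; last by apply: leq_trans KP; rewrite leq_exp2l //; lia.
rewrite -(expnM q K K) AE BE qE.
apply: (@hw_window d K w K.+1) => //; try lia.
  exact: linear_digits_weighted.
by rewrite !expnS expn0 in Kw; nia.
Qed.

Lemma square_window d K w r1 r2 s1 s2 A B oA oB :
  1 < d -> 2 < K -> d ^ 2 * K ^ 4 <= 2 ^ w ->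
  r1 = K /\ r2 = 1 \/ r1 = 1 /\ r2 = K -> 0 < s1 + s2 <= 2 * K + 1 ->
  let q := 2 ^ w * 2 ^ w in
  A = q ^ (r1 + K * K * s1) -> B = q ^ (r2 + K * K * s2) ->
  supplies oA (A ^ K) -> supplies oB (B ^ K) ->
  let m := output (Tsub d (2 ^ w) (2 ^ w - 1) (output (G024 A K (K - 1) oA))
                   (output (G024 B K (K - 1) oB))) %/ ((q ^ K) ^ K - 1) in
  HW m < w * (s1 + s2) * (K * K * (K - 1) %/ 2 + 2 * K) <= 2 * m.
Proof.
move=> d1 K2 dKP rK sK; cbv zeta; set q := _ * _ => AE BE oAE oBE.
have d0 := ltnW d1.
have KP : K ^ 4 <= 2 ^ w by apply: leq_trans dKP; rewrite leq_pmull // expn_gt0 d0.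
have K4 : 81 <= K ^ 4 by rewrite (leq_exp2r 3 K (isT : 0 < 4)).
have w6 : 6 < w by rewrite -(ltn_exp2l _ _ (isT : 1 < 2)); apply: leq_trans KP; apply: leq_trans K4.
have qE : q = 2 ^ (2 * w) by rewrite /q -expnD addnn mul2n.
have q33 : 33 <= q by rewrite qE; apply: (@leq_trans (2 ^ 6)) => //; rewrite leq_exp2l //; lia.
have q0 : 0 < q by apply: leq_trans q33.
have A33 : 33 <= A by rewrite AE; apply: leq_trans q33 _; apply: leq_expn_pos => //; lia.
have B33 : 33 <= B by rewrite BE; apply: leq_trans q33 _; apply: leq_expn_pos => //; lia.
rewrite !output_G024 //.
rewrite output_Tsub // -(expnM q K K) AE BE qE; apply: (@hw_window d K w 0) => //; try lia.
exact: square_digits_weighted.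
Qed.

(** In terms of [q], [Qx = q ^ (K + K ^ 2)], and [Qy = q ^ (1 + 2 * K ^ 3)] for the
    programs that recover both coordinates from one weight; the others use [q]
    itself. So the parameters [(s1, s2)] are [(1, 2 * K)], [(1, 0)], and [(0, 1)]
    for the second call of [QT]. *)
Lemma hw_choice_window v d X1 Y1 K w m :
  1 < d -> pell d X1 Y1 -> admissible v d K w X1 ->
  m = hw_argument v d K w \/ (v = QT /\ m = hw_argument_y d K w) ->
  HW m < Defs.eval (hw_choice v K w (K * K * (K - 1) %/ 2)) <= 2 * m.
Proof.
move=> d1 pellX [XK adm] mE.
have [X1_gt1 dX] := pell_bounds d1 pellX.
have K2 : 2 < K by apply: leq_ltn_trans XK.
have dK : d <= K ^ 2.
  by apply: ltnW; apply: leq_trans dX _; rewrite leq_exp2r // ltnW.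
have w3 : 8 * K ^ 3 <= (2 * K) ^ 3 by rewrite expnMn.
have w4 : 8 * K ^ 3 <= (2 * K) ^ 4 by apply: leq_trans w3 _; rewrite leq_exp2l //; lia.
have qx q : q ^ K * (q ^ K) ^ K = q ^ (K + K * K * 1) by rewrite -expnM -expnD muln1.
have qy0 q : q = q ^ (1 + K * K * 0) by rewrite muln0.
have qy q : q * (((q ^ K) ^ K) ^ K * ((q ^ K) ^ K) ^ K) = q ^ (1 + K * K * (2 * K)).
  by rewrite -{1}[q]expn1 -!expnM -!expnD; congr (_ ^ _); ring.
have eC v' : v' = SC \/ v' = QC ->
  Defs.eval (hw_choice v' K w (K * K * (K - 1) %/ 2)) =
    w * (1 + 2 * K) * (K * K * (K - 1) %/ 2 + 2 * K).
  by case=> -> /=; rewrite [2 * K + 1]addnC.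
have eO v' s1 s2 : s1 + s2 = 1 -> v' = SO \/ v' = QO \/ v' = QT ->
  Defs.eval (hw_choice v' K w (K * K * (K - 1) %/ 2)) =
    w * (s1 + s2) * (K * K * (K - 1) %/ 2 + 2 * K).
  by move=> -> [|[]] -> /=; rewrite muln1.
case: v adm mE => [[K64 wE]|[K64 wE]|dKP|[_ dKP]|dKP] [-> | [] // _ ->];
  rewrite ?(eC _ (or_introl erefl)) ?(eC _ (or_intror erefl)).
- apply: (@linear_window _ _ _ 1 (2 * K)) => //; [by rewrite wE | lia].
- rewrite (eO _ 1 0) //; last by left.
  apply: (@linear_window _ _ _ 1 0) => //; [by rewrite wE | lia].
- apply: (@square_window _ _ _ K 1 1 (2 * K)) => //; [left|]; lia.
- rewrite (eO _ 1 0) //; last by right; left.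
  apply: (@square_window _ _ _ K 1 1 0) => //; [left|]; lia.
- rewrite (eO _ 1 0) //; last by right; right.
  apply: (@square_window _ _ _ K 1 1 0) => //; [left|]; lia.
rewrite (eO _ 0 1) //; last by right; right.
apply: (@square_window _ _ _ 1 K 0 1) => //; [right|]; lia.
Qed.

(** * A logic for bit lengths *)

(** Every value computed by [x] is simply exponential in the scale [f]. The
    multiplier [a] is kept explicit so that the final constant is absolute. *)
Definition single_bounded (f a : nat) (x : expr) : Prop :=
  forall n, n \in rcons (subvalues x) (Defs.eval x) -> n <= 2 ^ (a * f).

Definition double_bounded (f a : nat) (x : expr) : Prop :=
  forall n, n \in rcons (subvalues x) (Defs.eval x) -> n <= 2 ^ 2 ^ (a * f).

Lemma single_eval f a x : single_bounded f a x -> Defs.eval x <= 2 ^ (a * f).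
Proof. by apply; rewrite mem_rcons inE eqxx. Qed.

Lemma double_eval f a x : double_bounded f a x -> Defs.eval x <= 2 ^ 2 ^ (a * f).
Proof. by apply; rewrite mem_rcons inE eqxx. Qed.

Lemma single_weaken f a b x : single_bounded f a x -> a <= b -> single_bounded f b x.
Proof.
by move=> ax ab n /ax le; rewrite (leq_trans le) // leq_exp2l // leq_mul2r ab orbT.
Qed.

Lemma double_weaken f a b x : double_bounded f a x -> a <= b -> double_bounded f b x.
Proof.
move=> ax ab n /ax le; rewrite (leq_trans le) // !leq_exp2l //.
by rewrite leq_mul2r ab orbT.
Qed.

Lemma double_of_single f a x : single_bounded f a x -> double_bounded f a x.
Proof. by move=> ax n /ax le; rewrite (leq_trans le) // leq_exp2l // ltnW // ltn_expl. Qed.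

Lemma single_val f a (n : nat) : n <= 2 ^ (a * f) -> single_bounded f a n.
Proof. by move=> le m; rewrite inE => /eqP->. Qed.

Lemma double_val f a (n : nat) : n <= 2 ^ 2 ^ (a * f) -> double_bounded f a n.
Proof. by move=> le m; rewrite inE => /eqP->. Qed.

Lemma single_literal f (n : nat) : 0 < f -> n <= 16 -> single_bounded f 4 n.
Proof.
move=> f0 n16; apply: single_val; apply: leq_trans n16 _.
by rewrite (@leq_exp2l 2 4) // leq_pmulr.
Qed.

Lemma single_bin f a b c o x y :
  single_bounded f a x -> single_bounded f b y -> a <= c -> b <= c ->
  apply_op o (Defs.eval x) (Defs.eval y) <= 2 ^ (c * f) -> single_bounded f c (Bin o x y).
Proof.
move=> ax bY ac bc le n; rewrite mem_rcons inE /= !mem_cat inE => /orP[/eqP->//|].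
have {}ax := single_weaken ax ac; have {}bY := single_weaken bY bc.
case/or3P => [nx|ny|/eqP->//]; first by apply: ax; rewrite mem_rcons inE nx orbT.
by apply: bY; rewrite mem_rcons inE ny orbT.
Qed.

Lemma double_bin f a b c o x y :
  double_bounded f a x -> double_bounded f b y -> a <= c -> b <= c ->
  apply_op o (Defs.eval x) (Defs.eval y) <= 2 ^ 2 ^ (c * f) -> double_bounded f c (Bin o x y).
Proof.
move=> ax bY ac bc le n; rewrite mem_rcons inE /= !mem_cat inE => /orP[/eqP->//|].
have {}ax := double_weaken ax ac; have {}bY := double_weaken bY bc.
case/or3P => [nx|ny|/eqP->//]; first by apply: ax; rewrite mem_rcons inE nx orbT.
by apply: bY; rewrite mem_rcons inE ny orbT.
Qed.

Lemma leq_expS c f m : 0 < f -> m <= 2 * 2 ^ (c * f) -> m <= 2 ^ (c.+1 * f).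
Proof.
by move=> f0 le; rewrite (leq_trans le) // -expnS leq_exp2l // mulSn -add1n leq_add2r.
Qed.

Lemma leq_exp_expS c f m : 0 < f -> m <= 2 ^ 2 ^ (c * f) * 2 ^ 2 ^ (c * f) ->
  m <= 2 ^ 2 ^ (c.+1 * f).
Proof.
move=> f0 le; rewrite (leq_trans le) // -expnD addnn -mul2n leq_exp2l //.
exact: leq_expS.
Qed.

Lemma single_add f a b x y : 0 < f -> single_bounded f a x -> single_bounded f b y ->
  single_bounded f (maxn a b).+1 (x + y)%X.
Proof.
move=> f0 ax bY; apply: (single_bin ax bY); try lia.
apply: leq_expS => //=; rewrite mul2n -addnn; apply: leq_add; apply: single_eval.
  by apply: single_weaken ax _; lia.
by apply: single_weaken bY _; lia.
Qed.

Lemma single_mul f a b x y : single_bounded f a x -> single_bounded f b y ->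
  single_bounded f (a + b) (x * y)%X.
Proof.
move=> ax bY; apply: (single_bin ax bY); try lia.
by rewrite /= mulnDl expnD leq_mul // single_eval.
Qed.

Lemma single_sub f a b x y : single_bounded f a x -> single_bounded f b y ->
  single_bounded f (maxn a b) (x - y)%X.
Proof.
move=> ax bY; apply: (single_bin ax bY); try lia.
apply: leq_trans (leq_subr _ _) (single_eval (single_weaken ax _)); lia.
Qed.

Lemma single_div f a b x y : single_bounded f a x -> single_bounded f b y ->
  single_bounded f (maxn a b) (x %/ y)%X.
Proof.
move=> ax bY; apply: (single_bin ax bY); try lia.
apply: leq_trans (leq_div _ _) (single_eval (single_weaken ax _)); lia.
Qed.

Lemma single_pow_literal f a x (j : nat) : 0 < j -> 0 < f -> j <= 16 ->
   single_bounded f a x -> single_bounded f (maxn (a * j) 4) (x ^ j)%X.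
Proof.
move=> j0 f0 j16 ax; apply: (single_bin ax (single_literal f0 j16)); try nia.
apply: (@leq_trans (2 ^ (a * j * f))); last by rewrite leq_exp2l // leq_mul2r leq_maxl orbT.
by rewrite /= mulnAC expnM leq_exp2r // single_eval.
Qed.

Lemma double_add f a b x y : 0 < f -> double_bounded f a x -> double_bounded f b y ->
  double_bounded f (maxn a b).+1 (x + y)%X.
Proof.
move=> f0 ax bY; apply: (double_bin ax bY); try lia.
have {}ax := double_eval (double_weaken ax (leq_maxl a b)).
have {}bY := double_eval (double_weaken bY (leq_maxr a b)).
apply: leq_exp_expS => //=.
have : 1 < 2 ^ 2 ^ (maxn a b * f) by rewrite -[1](expn0 2) ltn_exp2l // expn_gt0.
nia.
Qed.

Lemma double_mul f a b x y : 0 < f -> double_bounded f a x -> double_bounded f b y ->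
  double_bounded f (maxn a b).+1 (x * y)%X.
Proof.
move=> f0 ax bY; apply: (double_bin ax bY); try lia.
have {}ax := double_eval (double_weaken ax (leq_maxl a b)).
have {}bY := double_eval (double_weaken bY (leq_maxr a b)).
by apply: leq_exp_expS => //=; apply: leq_mul.
Qed.

Lemma double_sub f a b x y : double_bounded f a x -> double_bounded f b y ->
  double_bounded f (maxn a b) (x - y)%X.
Proof.
move=> ax bY; apply: (double_bin ax bY); try lia.
apply: leq_trans (leq_subr _ _) (double_eval (double_weaken ax _)); lia.
Qed.

Lemma double_div f a b x y : double_bounded f a x -> double_bounded f b y ->
  double_bounded f (maxn a b) (x %/ y)%X.
Proof.
move=> ax bY; apply: (double_bin ax bY); try lia.
apply: leq_trans (leq_div _ _) (double_eval (double_weaken ax _)); lia.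
Qed.

Lemma double_mod f a b x y : double_bounded f a x -> double_bounded f b y ->
  double_bounded f (maxn a b) (x %% y)%X.
Proof.
move=> ax bY; apply: (double_bin ax bY); try lia.
apply: leq_trans (leq_mod _ _) (double_eval (double_weaken ax _)); lia.
Qed.

(** [(2 ^ 2 ^ i) ^ (2 ^ j) = 2 ^ 2 ^ (i + j)]: a simply exponential exponent does
    not add a level. *)
Lemma double_pow f a b x y : double_bounded f a x -> single_bounded f b y ->
  double_bounded f (a + b) (x ^ y)%X.
Proof.
move=> ax bY; apply: (double_bin ax (double_of_single bY)); try lia.
apply: (@leq_trans ((2 ^ 2 ^ (a * f)) ^ Defs.eval y)).
  have [->|y0] := posnP (Defs.eval y); first by rewrite !expn0.
  by rewrite leq_exp2r // double_eval.
rewrite -expnM leq_exp2l // mulnDl expnD leq_mul2l; apply/orP; right.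
exact: single_eval.
Qed.

(** The judgement of the logic: [Q] is a postcondition, and the constant [c] is
    shared by all the steps of a program. *)
Definition run_spec (f c : nat) (A : Type) (r : run A) (Q : A -> Prop) : Prop :=
  (forall n, n \in intermediates r -> n <= 2 ^ 2 ^ (c * f)) /\ Q (output r).

Lemma spec_call f c A B (r : run A) (k : A -> run B) (Q : A -> Prop) Q' :
  run_spec f c r Q -> (forall u, Q u -> run_spec f c (k u) Q') ->
  run_spec f c (bind r k) Q'.
Proof.
move=> [r_le Qr] /(_ _ Qr)[k_le Qk]; split => // n; rewrite mem_cat => /orP[/r_le|/k_le] //.
Qed.

Lemma spec_weaken f c A (r : run A) (Q Q' : A -> Prop) :
  (forall u, Q u -> Q' u) -> run_spec f c r Q -> run_spec f c r Q'.
Proof. by move=> QQ [? ?]; split; auto. Qed.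

Lemma spec_ret f c A (a : A) (Q : A -> Prop) : Q a -> run_spec f c (ret a) Q.
Proof. by []. Qed.

Lemma spec_calc1 f c a x : single_bounded f a x -> a <= c ->
  run_spec f c (calc x) (fun n => n = Defs.eval x /\ n <= 2 ^ (a * f)).
Proof.
move=> ax ac; split; last by split; last exact: single_eval.
move=> n nx; apply: (double_weaken (double_of_single ax) ac).
by rewrite mem_rcons inE nx orbT.
Qed.

Lemma spec_calc2 f c a x : double_bounded f a x -> a <= c ->
  run_spec f c (calc x) (fun n => n = Defs.eval x /\ n <= 2 ^ 2 ^ (a * f)).
Proof.
move=> ax ac; split; last by split; last exact: double_eval.
by move=> n nx; apply: (double_weaken ax ac); rewrite mem_rcons inE nx orbT.
Qed.

Lemma spec_let1 a f c x B (k : nat -> run B) Q :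
  single_bounded f a x -> a <= c ->
  (forall n, n = Defs.eval x -> n <= 2 ^ (a * f) -> run_spec f c (k n) Q) ->
  run_spec f c (bind (calc x) k) Q.
Proof. by move=> ax ac ok; apply: spec_call (spec_calc1 ax ac) _ => n []; apply: ok. Qed.

Lemma spec_let2 a f c x B (k : nat -> run B) Q :
  double_bounded f a x -> a <= c ->
  (forall n, n = Defs.eval x -> n <= 2 ^ 2 ^ (a * f) -> run_spec f c (k n) Q) ->
  run_spec f c (bind (calc x) k) Q.
Proof. by move=> ax ac ok; apply: spec_call (spec_calc2 ax ac) _ => n []; apply: ok. Qed.

(** The two tactics follow the syntax of an expression and look up the bounds of
    its variables among the hypotheses; the multiplier that they find is compared
    with the one announced by [let1] or [let2]. *)
Ltac single_auto :=
  lazymatch goal with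
  | |- single_bounded _ _ (Val _) =>
      first [ apply: single_val; eassumption | exact: single_literal ]
  | |- single_bounded _ _ (Bin Add _ _) =>
      apply: single_add; [assumption | single_auto | single_auto]
  | |- single_bounded _ _ (Bin Mul _ _) => apply: single_mul; single_auto
  | |- single_bounded _ _ (Bin Monus _ _) => apply: single_sub; single_auto
  | |- single_bounded _ _ (Bin Div _ _) => apply: single_div; single_auto
  | |- single_bounded _ _ (Bin Pow _ _) =>
      apply: single_pow_literal; [done | assumption | done | single_auto]
  end.

Ltac double_auto :=
  lazymatch goal with
  | |- double_bounded _ _ (Val _) =>
      first [ apply: double_val; eassumption | apply: double_of_single; single_auto ]
  | |- double_bounded _ _ (Bin Add _ _) =>
      apply: double_add; [assumption | double_auto | double_auto]
  | |- double_bounded _ _ (Bin Mul _ _) =>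
      apply: double_mul; [assumption | double_auto | double_auto]
  | |- double_bounded _ _ (Bin Monus _ _) => apply: double_sub; double_auto
  | |- double_bounded _ _ (Bin Div _ _) => apply: double_div; double_auto
  | |- double_bounded _ _ (Bin Mod _ _) => apply: double_mod; double_auto
  | |- double_bounded _ _ (Bin Pow _ _) => apply: double_pow; [double_auto | single_auto]
  end.

Ltac let1 a :=
  apply: (@spec_let1 a); [ apply: single_weaken; [single_auto | done] | done | ].
Ltac let2 a :=
  apply: (@spec_let2 a); [ apply: double_weaken; [double_auto | done] | done | ].

(** Any number above all the multipliers occurring below. *)
Definition bit_constant := 300.

Lemma spec_power_if_needed f Q K oZ :
  supplies oZ (Q ^ K) -> Q ^ K <= 2 ^ (9 * f) ->
  run_spec f bit_constant (power_if_needed Q K oZ) (fun Z => Z <= 2 ^ (9 * f)).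
Proof.
case: oZ => [Z /= ->|_] le; first exact: spec_ret.
apply: spec_weaken (fun n => @proj2 _ _) (spec_calc1 _ (isT : 9 <= bit_constant)).
by move=> n; rewrite !inE orbb => /eqP ->.
Qed.

Lemma spec_G02 f Q K t oZ : 0 < f -> supplies oZ (Q ^ K) ->
  Q <= 2 ^ (9 * f) -> Q ^ K <= 2 ^ (9 * f) -> t <= 2 ^ (1 * f) ->
  run_spec f bit_constant (G02 Q K t oZ)
    (fun G => G.1 <= 2 ^ (9 * f) /\ G.2 <= 2 ^ (30 * f)).
Proof.
move=> f0 oZP QP ZP tP; rewrite /G02.
let1 9 => u _ uP.
apply: spec_call (spec_power_if_needed oZP ZP) _ => Z {}ZP.
let1 10 => v _ vP.
let1 10 => Qp _ QpP.
let1 27 => u3 _ u3P.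
let1 9 => G0 _ G0P.
let1 10 => z _ zP.
let1 21 => g2 _ g2P.
let1 30 => G2 _ G2P.
exact: spec_ret.
Qed.

Lemma spec_G024 f Q K t oZ : 0 < f -> supplies oZ (Q ^ K) ->
  Q <= 2 ^ (9 * f) -> Q ^ K <= 2 ^ (9 * f) -> t <= 2 ^ (1 * f) ->
  run_spec f bit_constant (G024 Q K t oZ)
    (fun G => [/\ G.1.1 <= 2 ^ (9 * f), G.1.2 <= 2 ^ (30 * f) & G.2 <= 2 ^ (52 * f)]).
Proof.
move=> f0 oZP QP ZP tP; rewrite /G024.
let1 9 => u _ uP.
apply: spec_call (spec_power_if_needed oZP ZP) _ => Z {}ZP.
let1 10 => v _ vP.
let1 10 => Qp _ QpP.
let1 27 => u3 _ u3P.
let1 9 => G0 _ G0P.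
let1 10 => z _ zP.
let1 21 => g2 _ g2P.
let1 30 => G2 _ G2P.
let1 45 => u5 _ u5P.
let1 20 => h _ hP.
let1 43 => g4 _ g4P.
let1 52 => G4 _ G4P.
exact: spec_ret.
Qed.

Lemma spec_Ssub f d P Pm U V : 0 < f ->
  d <= 2 ^ (1 * f) -> P <= 2 ^ (1 * f) -> Pm <= 2 ^ (1 * f) ->
  U.1 <= 2 ^ (9 * f) /\ U.2 <= 2 ^ (30 * f) ->
  V.1 <= 2 ^ (9 * f) /\ V.2 <= 2 ^ (30 * f) ->
  run_spec f bit_constant (Ssub d P Pm U V) (fun T => T <= 2 ^ (72 * f)).
Proof.
case: U V => U0 U2 [V0 V2] /= f0 dP PP PmP [U0P U2P] [V0P V2P].
apply: (spec_weaken (fun n => @proj2 _ _)); apply: spec_calc1 => //.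
by apply: single_weaken; [single_auto | done].
Qed.

Lemma spec_Tsub f d P Pm U V : 0 < f ->
  d <= 2 ^ (1 * f) -> P <= 2 ^ (1 * f) -> Pm <= 2 ^ (1 * f) ->
  [/\ U.1.1 <= 2 ^ (9 * f), U.1.2 <= 2 ^ (30 * f) & U.2 <= 2 ^ (52 * f)] ->
  [/\ V.1.1 <= 2 ^ (9 * f), V.1.2 <= 2 ^ (30 * f) & V.2 <= 2 ^ (52 * f)] ->
  run_spec f bit_constant (Tsub d P Pm U V) (fun T => T <= 2 ^ (72 * f)).
Proof.
case: U V => -[U0 U2] U4 [[V0 V2] V4] /= f0 dP PP PmP [U0P U2P U4P] [V0P V2P V4P].
let1 31 => D2 _ D2P.
let1 2 => d2 _ d2P.
apply: (spec_weaken (fun n => @proj2 _ _)); apply: spec_calc1 => //.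
by apply: single_weaken; [single_auto | done].
Qed.

(** The values [alpha < 2 ^ e] and [gamma = alpha * 2 ^ e] are again simply
    exponential, so that each power taken here has a simply exponential exponent. *)
Lemma spec_Hsub f m e : 0 < f -> m <= 2 ^ (72 * f) -> e <= 8 * f ->
  run_spec f bit_constant (Hsub m e) (fun H => H <= 2 ^ 2 ^ (200 * f)).
Proof.
move=> f0 mP e_le.
have PiP' : 2 ^ e <= 2 ^ (8 * f) by rewrite leq_exp2l.
have eP : e <= 2 ^ (8 * f) by apply: leq_trans PiP'; apply: ltnW; apply: ltn_expl.
rewrite /Hsub; apply: (@spec_call _ _ _ _ _ _ (fun=> True)) => // _ _.
let1 76 => a _ aP.
let2 100 => L _ LP.
apply: (@spec_let1 8).
  move=> n; rewrite !inE orbb => /eqP -> //.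
- by [].
move=> Pi PiE PiP.
let2 200 => alpha alphaE _.
(* The reduction modulo [2 ^ e] brings a doubly exponential value back down. *)
have alphaP : alpha <= 2 ^ (8 * f).
  apply: leq_trans PiP; rewrite alphaE /= ltnW // ltn_mod PiE expn_gt0 //.
let1 16 => gamma _ gammaP.
let2 70 => g _ gP.
let1 8 => u _ uP.
apply: (spec_weaken (fun n => @proj2 _ _)); apply: spec_calc2 => //.
by apply: double_weaken; [double_auto | done].
Qed.

Lemma spec_Rsub f d A B : 0 < f -> d <= 2 ^ (1 * f) -> A <= 2 ^ 2 ^ (210 * f) ->
  B <= 2 ^ 2 ^ (210 * f) -> run_spec f bit_constant (Rsub d A B) (fun=> True).
Proof.
move=> f0 dP AP BP; rewrite /Rsub.
let2 220 => VB _ VBP.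
let2 225 => c _ cP.
let2 230 => Vc _ VcP.
let2 235 => Dc _ DcP.
let2 240 => X _ XP.
let2 240 => Y _ YP.
exact: spec_ret.
Qed.

Lemma spec_Csub f d K A p v : 0 < f -> d <= 2 ^ (1 * f) -> K <= 2 ^ (1 * f) ->
  A <= 2 ^ 2 ^ (200 * f) -> p <= 2 ^ (9 * f) -> v <= 2 ^ (9 * f) ->
  run_spec f bit_constant (Csub d K A p v) (fun B => B <= 2 ^ 2 ^ (210 * f)).
Proof.
move=> f0 dP KP AP pP vP; rewrite /Csub.
let1 5 => h _ hP.
let1 10 => zc _ zcP.
let2 20 => cK _ cKP.
let1 6 => Hc _ HcP.
let2 30 => cdK _ cdKP.
let2 30 => ac _ acP.
apply: (spec_weaken (fun n => @proj2 _ _)); apply: spec_calc2 => //.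
by apply: double_weaken; [double_auto | done].
Qed.

Lemma spec_decode_C f d K w sigma HM : 0 < f -> d <= 2 ^ (1 * f) -> K <= 2 ^ (1 * f) ->
  w <= 2 ^ (1 * f) -> sigma <= 2 ^ (4 * f) -> HM <= 2 ^ 2 ^ (200 * f) ->
  run_spec f bit_constant (decode_C d K w sigma HM) (fun=> True).
Proof.
move=> f0 dP KP wP sP HP; rewrite /decode_C.
let1 5 => C _ CP.
let1 6 => Cp _ CpP.
let1 10 => WC _ WCP.
let2 210 => RC _ RCP.
let2 210 => A _ AP.
let2 210 => B _ BP.
exact: spec_Rsub.
Qed.

Lemma spec_decode_O f d K w sigma q1 q2 HM :
  0 < f -> d <= 2 ^ (1 * f) -> K <= 2 ^ (1 * f) ->
  w <= 2 ^ (1 * f) -> sigma <= 2 ^ (4 * f) -> q1 <= 2 ^ (9 * f) -> q2 <= 2 ^ (9 * f) ->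
  HM <= 2 ^ 2 ^ (200 * f) ->
  run_spec f bit_constant (decode_O d K w sigma q1 q2 HM) (fun=> True).
Proof.
move=> f0 dP KP wP sP q1P q2P HP; rewrite /decode_O.
let2 200 => A _ AP.
apply: spec_call; first exact: spec_Csub AP q1P q2P.
move=> B BP; apply: spec_Rsub => //.
by apply: leq_trans AP _; rewrite !leq_exp2l // leq_mul2r orbT.
Qed.

(** * Bit lengths in the programs *)

Lemma single_pow f a (q K : nat) : q ^ K <= 2 ^ (a * f) -> single_bounded f a (q ^ K)%X.
Proof. by move=> le n; rewrite !inE orbb => /eqP ->. Qed.

Ltac letpow a :=
  apply: (@spec_let1 a); [ apply: single_pow | done | ].

Lemma hw_choice_leq f K w s : 1 < K -> s = K * K * (K - 1) %/ 2 ->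
  w * K ^ 3 <= f -> w * (s + 2 * K) <= 8 * f.
Proof.
move=> K1 sE wf; apply: (@leq_trans (8 * (w * K ^ 3))); last by rewrite leq_mul2l.
rewrite mulnCA leq_mul2l; apply/orP; right.
have := leq_trunc_div (K * K * (K - 1)) 2; rewrite -sE; nia.
Qed.

(** For one coordinate at a time the largest power is [Q ^ K = q ^ (K ^ 2 + K ^ 3)]. *)
Lemma power_tower_bounds f j w K q : q = 2 ^ (j * w) -> j <= 3 -> 1 < K -> w * K ^ 3 <= f ->
  [/\ q <= 2 ^ (9 * f), q ^ K <= 2 ^ (9 * f), (q ^ K) ^ K <= 2 ^ (9 * f),
      q ^ K * (q ^ K) ^ K <= 2 ^ (9 * f) &
      (q ^ K * (q ^ K) ^ K) ^ K <= 2 ^ (9 * f)].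
Proof.
move=> -> j3 K1 wKf; rewrite -!expnM -!expnD -!expnM !leq_exp2l //.
have le N : N <= 3 * K ^ 3 -> j * w * N <= 9 * f.
  move=> NK; apply: (@leq_trans (3 * w * (3 * K ^ 3))); first by rewrite !leq_mul.
  by rewrite mulnACA leq_mul2l.
have KK : K * 2 <= K * K by rewrite leq_mul2l K1 orbT.
have KKK : K * K * 2 <= K * K * K by rewrite leq_mul2l K1 orbT.
rewrite !expnS expn0 muln1 mulnA in le.
by split; [apply: leq_trans (le 1 _) | apply: leq_trans (le K _)
  | apply: leq_trans (le (K * K) _) | apply: leq_trans (le (K + K * K) _)
  | apply: leq_trans (le ((K + K * K) * K) _)]; lia.
Qed.

(** For both coordinates at once the largest power is [Qy ^ K = q ^ (K + 2 * K ^ 4)],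
    which is the reason for the exponent 4 instead of 3. *)
Lemma power_tower_bounds_C f j w K q : q = 2 ^ (j * w) -> j <= 3 -> 1 < K -> w * K ^ 4 <= f ->
  let q3 := ((q ^ K) ^ K) ^ K in
  [/\ q3 <= 2 ^ (9 * f), q * (q3 * q3) <= 2 ^ (9 * f) & (q * (q3 * q3)) ^ K <= 2 ^ (9 * f)].
Proof.
move=> -> j3 K1 wKf; cbv zeta; rewrite -!expnM -!expnD -!expnM !leq_exp2l //.
have le N : N <= 3 * K ^ 4 -> j * w * N <= 9 * f.
  move=> NK; apply: (@leq_trans (3 * w * (3 * K ^ 4))); first by rewrite !leq_mul.
  by rewrite mulnACA leq_mul2l.
have KK : K * 2 <= K * K by rewrite leq_mul2l K1 orbT.
have KKK : K * K * 2 <= K * K * K by rewrite leq_mul2l K1 orbT.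
have K4 : K * K * K * 2 <= K * K * K * K by rewrite leq_mul2l K1 orbT.
rewrite !expnS expn0 muln1 !mulnA in le.
by split; [apply: leq_trans (le (K * K * K) _) | apply: leq_trans (le (1 + 2 * (K * K * K)) _)
  | apply: leq_trans (le (K + 2 * (K * K * K * K)) _)]; lia.
Qed.

Lemma single_val_bounds f d K w : 0 < w -> 1 < K -> d <= K -> w * K ^ 3 <= f ->
  [/\ 0 < f, w <= f, w <= 2 ^ (1 * f), K <= 2 ^ (1 * f) & d <= 2 ^ (1 * f)].
Proof.
move=> w0 K1 dK wKf.
have K3 : K <= K ^ 3 by apply: leq_expn_pos => //; lia.
have wf : w <= f by apply: leq_trans wKf; rewrite leq_pmulr //; lia.
have Kf : K <= f by apply: leq_trans wKf; apply: leq_trans K3 _; rewrite leq_pmull.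
have f_lt := ltnW (ltn_expl f (isT : 1 < 2)).
by split; rewrite ?mul1n //; lia.
Qed.

Lemma hw_choice_leq_C f K w s : 1 < K -> s = K * K * (K - 1) %/ 2 ->
  w * K ^ 4 <= f -> w * (2 * K + 1) * (s + 2 * K) <= 8 * f.
Proof.
move=> K1 sE wf; apply: (@leq_trans (8 * (w * K ^ 4))); last by rewrite leq_mul2l.
rewrite mulnCA -mulnA leq_mul2l; apply/orP; right.
have s_le : s + 2 * K <= 2 * K ^ 3.
  have := leq_trunc_div (K * K * (K - 1)) 2; rewrite -sE; nia.
by apply: leq_trans (leq_mul (leqnn _) s_le) _; rewrite !expnS; nia.
Qed.

Lemma spec_program_SC f d K w : 0 < w -> 1 < K -> d <= K -> w * K ^ 4 <= f ->
  run_spec f bit_constant (program_SC d K w) (fun=> True).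
Proof.
move=> w0 K1 dK wKf4; have wKf : w * K ^ 3 <= f.
  by apply: leq_trans wKf4; rewrite leq_mul2l leq_exp2l // orbT.
have [f0 wf wP KP dP] := single_val_bounds w0 K1 dK wKf.
have qw : (2 ^ w) ^ 3 = 2 ^ (3 * w) by rewrite -expnM mulnC.
have [qP q1P q2P QP ZP] := power_tower_bounds qw isT K1 wKf.
have [q3P QyP ZyP] := power_tower_bounds_C qw isT K1 wKf4.
rewrite /program_SC /hw_choice.
let1 4 => t tE _; letpow 1 => [|P PE PP]; first by rewrite mul1n leq_exp2l.
let1 4 => Pm PmE _; apply: (@spec_let1 9); [apply: single_pow; rewrite PE //| done |] => q qE _.
have {}tE : t = K - 1 := tE; have {}PmE : Pm = P - 1 := PmE.
have {}qE : q = P ^ 3 := qE; have {}PE : P = 2 ^ w := PE.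
rewrite -PE -qE in qP q1P q2P QP ZP q3P QyP ZyP.
have tP : t <= 2 ^ (1 * f) by apply: leq_trans KP; rewrite tE leq_subr.
have PmP : Pm <= 2 ^ (1 * f) by apply: leq_trans PP; rewrite PmE leq_subr.
letpow 9 => [//|_ -> _]; letpow 9 => [//|_ -> _].
let1 4 => s sE sP; let1 20 => e eE _; letpow 9 => [//|_ -> _]; let1 18 => _ -> _; let1 27 => _ -> _.
have e_le : e <= 8 * f by rewrite eE; apply: hw_choice_leq_C => //; rewrite sE tE.
apply: spec_call (spec_G02 f0 _ QP ZP tP) _ => // U UP.
apply: spec_call (spec_G02 f0 _ QyP ZyP tP) _ => // V VP.
apply: spec_call (spec_Ssub f0 dP PP PmP UP VP) _ => T TP.
let1 72 => M _ MP; apply: spec_call (spec_Hsub f0 MP e_le) _ => H HP.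
exact: spec_decode_C.
Qed.

Lemma spec_program_SO f d K w : 0 < w -> 1 < K -> d <= K -> w * K ^ 3 <= f ->
  run_spec f bit_constant (program_SO d K w) (fun=> True).
Proof.
move=> w0 K1 dK wKf; have [f0 wf wP KP dP] := single_val_bounds w0 K1 dK wKf.
have qw : (2 ^ w) ^ 3 = 2 ^ (3 * w) by rewrite -expnM mulnC.
have [qP q1P q2P QP ZP] := power_tower_bounds qw isT K1 wKf.
rewrite /program_SO /hw_choice.
let1 4 => t tE _; letpow 1 => [|P PE PP]; first by rewrite mul1n leq_exp2l.
let1 4 => Pm PmE _; apply: (@spec_let1 9); [apply: single_pow; rewrite PE //| done |] => q qE _.
have {}tE : t = K - 1 := tE; have {}PmE : Pm = P - 1 := PmE.
have {}qE : q = P ^ 3 := qE; have {}PE : P = 2 ^ w := PE.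
rewrite -PE -qE in qP q1P q2P QP ZP.
have tP : t <= 2 ^ (1 * f) by apply: leq_trans KP; rewrite tE leq_subr.
have PmP : Pm <= 2 ^ (1 * f) by apply: leq_trans PP; rewrite PmE leq_subr.
letpow 9 => [//|_ -> _]; letpow 9 => [//|_ -> _].
let1 4 => s sE sP; let1 20 => e eE _; let1 18 => _ -> _.
have e_le : e <= 8 * f by rewrite eE; apply: hw_choice_leq => //; rewrite sE tE.
apply: spec_call (spec_G02 f0 _ QP ZP tP) _ => // U UP.
apply: spec_call (spec_G02 f0 (erefl : supplies (Some _) _) qP q1P tP) _ => V VP.
apply: spec_call (spec_Ssub f0 dP PP PmP UP VP) _ => T TP.
let1 72 => M _ MP; apply: spec_call (spec_Hsub f0 MP e_le) _ => H HP.
exact: spec_decode_O.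
Qed.

Lemma spec_program_QC f d K w : 0 < w -> 1 < K -> d <= K -> w * K ^ 4 <= f ->
  run_spec f bit_constant (program_QC d K w) (fun=> True).
Proof.
move=> w0 K1 dK wKf4; have wKf : w * K ^ 3 <= f.
  by apply: leq_trans wKf4; rewrite leq_mul2l leq_exp2l // orbT.
have [f0 wf wP KP dP] := single_val_bounds w0 K1 dK wKf.
have qw : 2 ^ w * 2 ^ w = 2 ^ (2 * w) by rewrite -expnD addnn mul2n.
have [qP q1P q2P QP ZP] := power_tower_bounds qw isT K1 wKf.
have [q3P QyP ZyP] := power_tower_bounds_C qw isT K1 wKf4.
rewrite /program_QC /hw_choice.
let1 4 => t tE _; letpow 1 => [|P PE PP]; first by rewrite mul1n leq_exp2l.
let1 4 => Pm PmE _; let1 2 => q qE _.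
have {}tE : t = K - 1 := tE; have {}PmE : Pm = P - 1 := PmE.
have {}qE : q = P * P := qE; have {}PE : P = 2 ^ w := PE.
rewrite -PE -qE in qP q1P q2P QP ZP q3P QyP ZyP.
have tP : t <= 2 ^ (1 * f) by apply: leq_trans KP; rewrite tE leq_subr.
have PmP : Pm <= 2 ^ (1 * f) by apply: leq_trans PP; rewrite PmE leq_subr.
letpow 9 => [//|_ -> _]; letpow 9 => [//|_ -> _].
let1 4 => s sE sP; let1 20 => e eE _; letpow 9 => [//|_ -> _]; let1 18 => _ -> _; let1 27 => _ -> _.
have e_le : e <= 8 * f by rewrite eE; apply: hw_choice_leq_C => //; rewrite sE tE.
apply: spec_call (spec_G024 f0 _ QP ZP tP) _ => // U UP.
apply: spec_call (spec_G024 f0 _ QyP ZyP tP) _ => // V VP.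
apply: spec_call (spec_Tsub f0 dP PP PmP UP VP) _ => T TP.
let1 72 => M _ MP; apply: spec_call (spec_Hsub f0 MP e_le) _ => H HP.
exact: spec_decode_C.
Qed.

Lemma spec_program_QO f d K w : 0 < w -> 1 < K -> d <= K -> w * K ^ 3 <= f ->
  run_spec f bit_constant (program_QO d K w) (fun=> True).
Proof.
move=> w0 K1 dK wKf; have [f0 wf wP KP dP] := single_val_bounds w0 K1 dK wKf.
have qw : 2 ^ w * 2 ^ w = 2 ^ (2 * w) by rewrite -expnD addnn mul2n.
have [qP q1P q2P QP ZP] := power_tower_bounds qw isT K1 wKf.
rewrite /program_QO /hw_choice.
let1 4 => t tE _; letpow 1 => [|P PE PP]; first by rewrite mul1n leq_exp2l.
let1 4 => Pm PmE _; let1 2 => q qE _.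
have {}tE : t = K - 1 := tE; have {}PmE : Pm = P - 1 := PmE.
have {}qE : q = P * P := qE; have {}PE : P = 2 ^ w := PE.
rewrite -PE -qE in qP q1P q2P QP ZP.
have tP : t <= 2 ^ (1 * f) by apply: leq_trans KP; rewrite tE leq_subr.
have PmP : Pm <= 2 ^ (1 * f) by apply: leq_trans PP; rewrite PmE leq_subr.
letpow 9 => [//|_ -> _]; letpow 9 => [//|_ -> _].
let1 4 => s sE sP; let1 20 => e eE _; let1 18 => _ -> _.
have e_le : e <= 8 * f by rewrite eE; apply: hw_choice_leq => //; rewrite sE tE.
apply: spec_call (spec_G024 f0 _ QP ZP tP) _ => // U UP.
apply: spec_call (spec_G024 f0 (erefl : supplies (Some _) _) qP q1P tP) _ => V VP.
apply: spec_call (spec_Tsub f0 dP PP PmP UP VP) _ => T TP.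
let1 72 => M _ MP; apply: spec_call (spec_Hsub f0 MP e_le) _ => H HP.
exact: spec_decode_O.
Qed.

Lemma spec_program_QT f d K w : 0 < w -> 1 < K -> d <= K -> w * K ^ 3 <= f ->
  run_spec f bit_constant (program_QT d K w) (fun=> True).
Proof.
move=> w0 K1 dK wKf; have [f0 wf wP KP dP] := single_val_bounds w0 K1 dK wKf.
have qw : 2 ^ w * 2 ^ w = 2 ^ (2 * w) by rewrite -expnD addnn mul2n.
have [qP q1P q2P QP ZP] := power_tower_bounds qw isT K1 wKf.
rewrite /program_QT /hw_choice.
let1 4 => t tE _; letpow 1 => [|P PE PP]; first by rewrite mul1n leq_exp2l.
let1 4 => Pm PmE _; let1 2 => q qE _.
have {}tE : t = K - 1 := tE; have {}PmE : Pm = P - 1 := PmE.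
have {}qE : q = P * P := qE; have {}PE : P = 2 ^ w := PE.
rewrite -PE -qE in qP q1P q2P QP ZP.
have tP : t <= 2 ^ (1 * f) by apply: leq_trans KP; rewrite tE leq_subr.
have PmP : Pm <= 2 ^ (1 * f) by apply: leq_trans PP; rewrite PmE leq_subr.
letpow 9 => [//|_ -> _]; letpow 9 => [//|_ -> _].
let1 4 => s sE sP; let1 20 => e eE _; let1 18 => _ -> _.
have e_le : e <= 8 * f by rewrite eE; apply: hw_choice_leq => //; rewrite sE tE.
apply: spec_call (spec_G024 f0 _ QP ZP tP) _ => // U UP.
apply: spec_call (spec_G024 f0 (erefl : supplies (Some _) _) qP q1P tP) _ => V VP.
apply: spec_call (spec_Tsub f0 dP PP PmP UP VP) _ => Tx TxP.
apply: spec_call (spec_Tsub f0 dP PP PmP VP UP) _ => Ty TyP.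
let1 9 => Dq _ DqP; let1 72 => Mx _ MxP; let1 72 => My _ MyP.
apply: spec_call (spec_Hsub f0 MxP e_le) _ => Hx HxP.
apply: spec_call (spec_Hsub f0 MyP e_le) _ => Hy HyP.
let2 210 => A _ AP; let2 210 => B _ BP.
exact: spec_Rsub.
Qed.

Lemma max_bitlen_program_leq v f d K w : 0 < w -> 1 < K -> d <= K ->
  w * K ^ (if v is (SC | QC) then 4 else 3) <= f ->
  max_bitlen (program v d K w) <= 2 ^ (bit_constant.+1 * f).
Proof.
move=> w0 K1 dK wf.
have f0 : 0 < f.
  by apply: leq_trans wf; rewrite muln_gt0 w0 expn_gt0 ltnW.
have [le _] : run_spec f bit_constant (program v d K w) (fun=> True).
  case: v wf; [exact: spec_program_SC | exact: spec_program_SO |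
    exact: spec_program_QC | exact: spec_program_QO | exact: spec_program_QT].
apply/bigmax_leqP_seq => n /le {}le _; rewrite bitlen_leq.
by apply: leq_ltn_trans le _; rewrite !ltn_exp2l // ltn_mul2r f0 ltnSn.
Qed.

Definition prescribed_width (v : variant) (K w : nat) : Prop :=
  match v with
  | SC => w = (2 * K) ^ 4
  | SO => w = (2 * K) ^ 3
  | _ => True
  end.

(** For [SC] and [SO] the prescribed [w] turns the scales [w * K ^ 4] and
    [w * K ^ 3] into [16 * K ^ 8] and [8 * K ^ 6]. *)
Lemma max_bitlen_bit_exponent v d K w : 0 < w -> 1 < K -> d <= K -> prescribed_width v K w ->
  max_bitlen (program v d K w) <= 2 ^ (bit_constant.+1 * 16 * bit_exponent v K w).
Proof.
move=> w0 K1 dK wE; rewrite -mulnA; apply: max_bitlen_program_leq => //.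
case: v wE => /= [->|->|_|_|_]; try by rewrite leq_pmull.
  by rewrite expnMn -mulnA -expnD.
by rewrite expnMn -mulnA -expnD leq_mul2r orbT.
Qed.

(** * Elementary and Hua parameters *)

Lemma elementary_bit_exponent v d : 0 < d ->
  bit_exponent v (elementary_K d) (elementary_w v d) <= 2 ^ (48 * d).
Proof.
move=> d0; have KE : elementary_K d = 2 ^ (6 * d) by rewrite /elementary_K expnM.
have w_le : 26 * d <= 2 ^ (6 * d).
  apply: (@leq_trans (2 ^ (5 * d) * 2 ^ d)); last by rewrite -expnD leq_exp2l //; lia.
  rewrite leq_mul ?(ltnW (ltn_expl _ _)) // (@leq_trans (2 ^ 5)) //.
  by rewrite leq_exp2l // leq_pmulr.
case: v => /=; rewrite KE -!expnM; try by rewrite leq_exp2l //; lia.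
all: by apply: leq_trans (leq_mul w_le (leqnn _)) _; rewrite -expnD leq_exp2l //; lia.
Qed.

Lemma central_binomial_rec m :
  m.+1 * 'C(2 * m.+1, m.+1) = 2 * (2 * m + 1) * 'C(2 * m, m).
Proof.
have := mul_bin_diag (2 * m.+1) m; have := mul_bin_down (2 * m).+1 m.
have -> : 2 * m.+1 = (2 * m).+2 by lia.
have -> : (2 * m).+1 - m = m.+1 by lia.
rewrite /= => e1 <-; apply/eqP; rewrite -(eqn_pmul2l (ltn0Sn m)); apply/eqP.
transitivity ((2 * m).+2 * (m.+1 * 'C((2 * m).+1, m))); first by ring.
by rewrite -e1; ring.
Qed.

(** Going from [n] to [n + 1] multiplies the right-hand side by
    [4 * (2 * n + 1) ^ 2 / (n * (n + 1)) >= 16]. *)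
Lemma central_binomial_lower n : 0 < n -> 16 ^ n <= 4 * n * 'C(2 * n, n) ^ 2.
Proof.
case: n => // n _; elim: n => [|n IHn]; first by [].
have step := central_binomial_rec n.+1.
rewrite expnS; apply: leq_trans (leq_mul (leqnn 16) IHn) _.
rewrite -(leq_pmul2l (isT : 0 < n.+2)).
have -> : n.+2 * (4 * n.+2 * 'C(2 * n.+2, n.+2) ^ 2) = 4 * (n.+2 * 'C(2 * n.+2, n.+2)) ^ 2 by ring.
rewrite step; move: 'C(_, _) => C.
have -> : n.+2 * (16 * (4 * n.+1 * C ^ 2)) = 64 * n.+2 * n.+1 * C ^ 2 by ring.
have -> : 4 * (2 * (2 * n.+1 + 1) * C) ^ 2 = 16 * (2 * n.+1 + 1) ^ 2 * C ^ 2 by ring.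
by rewrite leq_mul2r; apply/orP; right; nia.
Qed.

Lemma hua_r_gt0 d : 0 < hua_r d.
Proof.
rewrite divn_gt0 ?bin_gt0 ?leq_pmull // //.
have -> : 4 ^ d = (1 + 1) ^ (2 * d) by rewrite expnM.
rewrite expnDn.
have lt : d < (2 * d).+1 by lia.
by rewrite (bigD1 (Ordinal lt)) //= !exp1n !muln1 leq_addr.
Qed.

Lemma hua_r_sqr d : 0 < d -> hua_r d ^ 2 <= 4 * d.
Proof.
move=> d0; have C0 : 0 < 'C(2 * d, d) by rewrite bin_gt0 leq_pmull.
rewrite -(leq_pmul2r (_ : 0 < 'C(2 * d, d) ^ 2)) ?expn_gt0 ?C0 // -expnMn.
apply: leq_trans (central_binomial_lower d0).
have -> : 16 ^ d = (4 ^ d) ^ 2 by rewrite expnAC.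
by rewrite leq_exp2r // leq_trunc_div.
Qed.

(** Both [32 * d] and [d + 5] are at most [2 ^ (6 * up_log 2 d)], and [K] is the [hua_r d]-th power of [32 * d]. *)
Lemma hua_bit_exponent v d : 1 < d ->
  bit_exponent v (hua_K d) (hua_w v d) <= 2 ^ (48 * (hua_r d * up_log 2 d)).
Proof.
move=> d1; have r0 := hua_r_gt0 d; set l := up_log 2 d.
have l0 : 0 < l by rewrite up_log_gt0.
have dl : d <= 2 ^ l by exact: up_logP.
have K_le : hua_K d <= 2 ^ (6 * (hua_r d * l)).
  rewrite /hua_K [hua_r d * l]mulnC mulnA expnM leq_exp2r //.
  apply: leq_trans (leq_mul (leqnn 32) dl) _; rewrite -(@expnD 2 5) leq_exp2l //; lia.
have w_le : (4 * hua_r d + 2) * (d + 5) <= 2 ^ (8 * (hua_r d * l)).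
  apply: (@leq_trans (2 ^ (3 + hua_r d) * 2 ^ (3 + l))); last by rewrite -expnD leq_exp2l //; nia.
  have r_lt := ltn_expl (hua_r d) (isT : 1 < 2).
  by apply: leq_mul; rewrite expnD; lia.
have K_pow j : 0 < j -> hua_K d ^ j <= 2 ^ (6 * (hua_r d * l) * j).
  by move=> j0; rewrite expnM leq_exp2r.
case: v => /=; try by apply: leq_trans (K_pow _ (ltn0Sn _)) _; rewrite leq_exp2l //; lia.
all: by apply: leq_trans (leq_mul w_le (K_pow _ (ltn0Sn _))) _; rewrite -expnD leq_exp2l //; lia.
Qed.

(** Here the scale is the length of [d]: then [2 ^ (2 * d)] and its powers are
    doubly exponential. *)
Lemma max_bitlen_hua_r_computation d : 1 < d ->
  max_bitlen (hua_r_computation d) <= 2 ^ (bit_constant.+1 * up_log 2 d).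
Proof.
move=> d1; have f0 : 0 < up_log 2 d by rewrite up_log_gt0.
set f := up_log 2 d in f0 *.
have dP : d <= 2 ^ (1 * f) by rewrite mul1n; exact: up_logP.
have [le _] : run_spec f bit_constant (hua_r_computation d) (fun=> True).
  rewrite /hua_r_computation.
  let1 5 => h _ hP; let2 10 => L _ LP; let2 20 => c _ cP.
  apply: (@spec_weaken _ _ _ _ _ _ (fun _ _ => I)); apply: (@spec_calc2 _ _ 20) => //.
  by apply: double_weaken; [double_auto | done].
apply/bigmax_leqP_seq => n /le {}le _; rewrite bitlen_leq.
by apply: leq_ltn_trans le _; rewrite !ltn_exp2l // ltn_mul2r f0 ltnSn.
Qed.

Section RealExponents.
Import Order.TTheory GRing.Theory Num.Theory.
Local Open Scope ring_scope.

(** The estimates are [hua_r d <= 2 * sqrt d] and, since [2 ^ (up_log 2 d - 1) < d],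
    [up_log 2 d * ln 2 <= ln d + ln 2 <= 2 * ln d]. *)
Lemma hua_exponent_bound (R : realType) d : (1 < d)%N ->
  (hua_r d * up_log 2 d)%:R <= 4 / ln 2 * (Num.sqrt d%:R * ln d%:R) :> R.
Proof.
move=> d1; have ln2 : 0 < ln 2 :> R by rewrite ln_gt0 // ltr1n.
have r_le : (hua_r d)%:R <= 2 * Num.sqrt d%:R :> R.
  rewrite -ler_sqr ?nnegrE ?mulr_ge0 ?sqrtr_ge0 // exprMn sqr_sqrtr //.
  by rewrite -!natrX -natrM ler_nat hua_r_sqr // ltnW.
have l_le : (up_log 2 d)%:R <= 2 / ln 2 * ln d%:R :> R.
  rewrite mulrAC ler_pdivlMr //.
  have le_d : (2 ^ (up_log 2 d).-1 <= d)%N by rewrite ltnW // up_log_gtn.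
  have le_ln : (up_log 2 d).-1%:R * ln 2 <= ln d%:R :> R.
    by rewrite mulr_natl -lnXn // -natrX ler_ln ?posrE ?ltr0n ?expn_gt0 ?ler_nat // ltnW.
  have le_2 : ln 2 <= ln d%:R :> R by rewrite ler_ln ?posrE ?ltr0n ?ler_nat // ltnW.
  have l0 : (0 < up_log 2 d)%N by rewrite up_log_gt0.
  rewrite -(prednK l0) -natr1; lra.
rewrite natrM; apply: le_trans (ler_pM _ _ r_le l_le) _ => //; lra.
Qed.

Lemma double_exponential_bound (R : realType) (n k : nat) (x : R) :
  (n <= 2 ^ 2 ^ k)%N -> k%:R <= x -> n%:R <= 2 `^ (2 `^ x) :> R.
Proof.
move=> n_le k_le; apply: (@le_trans _ _ ((2 ^ 2 ^ k)%N%:R)); first by rewrite ler_nat.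
rewrite natrX -powR_mulrn //; apply: ler_powR; first by rewrite ler1n.
by rewrite natrX -powR_mulrn //; apply: ler_powR; rewrite ?ler1n.
Qed.

End RealExponents.

(** * Bounds for the five programs *)

Theorem proposition17 (R : realType) :
  [/\ (forall (d X1 Y1 : nat) (v : variant) (K w : nat),
         (2 <= d)%N -> nonsquare d -> fundamental_solution d X1 Y1 ->
         admissible v d K w X1 ->
         forall m e : nat, (m, e) \in hw_calls (program v d K w) ->
           (HW m < e <= 2 * m)%N),
      (exists c : nat,
         forall (d X1 Y1 : nat) (v : variant) (K w : nat),
         (2 <= d)%N -> nonsquare d -> fundamental_solution d X1 Y1 ->
         admissible v d K w X1 -> (d <= K)%N ->
           (max_bitlen (program v d K w) <= 2 ^ (c * bit_exponent v K w))%N),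
      (exists c : nat,
         forall (d : nat) (v : variant),
         (2 <= d)%N -> nonsquare d ->
           (max_bitlen (program v d (elementary_K d) (elementary_w v d))
              <= 2 ^ (2 ^ (c * d)))%N)
    & (exists c : R,
         forall (d : nat) (v : variant),
         (2 <= d)%N -> nonsquare d ->
         let bound : R :=
           (2 `^ (2 `^ (c * (Num.sqrt d%:R * ln d%:R))))%R in
           ((max_bitlen (hua_r_computation d))%:R <= bound)%R /\
           ((max_bitlen (program v d (hua_K d) (hua_w v d)))%:R <= bound)%R)].
Proof.
have constant_le : (bit_constant.+1 * 16 <= 2 ^ 13)%N by [].
split.
- move=> d X1 Y1 v K w d1 _ [pellX _] adm m e; rewrite hw_calls_program inE.
  case/orP => [/eqP[-> ->]|]; first by apply: (hw_choice_window d1 pellX adm); left.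
  by case: v adm => // adm; rewrite inE => /eqP[-> ->];
    apply: (hw_choice_window d1 pellX adm); right.
- exists (bit_constant.+1 * 16)%N => d X1 Y1 v K w d1 _ [pellX _] [XK adm] dK.
  have [X1_gt1 _] := pell_bounds d1 pellX.
  have K1 : (1 < K)%N by apply: ltn_trans XK.
  have dK_gt1 : (1 < d ^ 2 * K ^ 4)%N.
    rewrite (@leq_trans (d ^ 2)) ?leq_pmulr ?expn_gt0 ?(ltnW K1) //.
    by rewrite (leq_trans d1) // leq_expn_pos // ltnW.
  have w0 : (0 < w)%N.
    case: (posnP w) adm => // ->.
    have nK j : (0 = (2 * K) ^ j -> False)%N by move=> /esym/eqP; rewrite expn_eq0; lia.
    by case: v => [[_ /nK]|[_ /nK]|le|[_ le]|le] //; rewrite leqNgt dK_gt1 in le.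
  apply: max_bitlen_bit_exponent => //.
  by case: v adm => [[_ ->]|[_ ->]|le|[_ le]|le].
- exists 61 => d v d1 _.
  have K1 : (1 < elementary_K d)%N by rewrite -[1%N](expn0 64) ltn_exp2l // ltnW.
  have dK : (d <= elementary_K d)%N by rewrite ltnW // ltn_expl.
  have w0 : (0 < elementary_w v d)%N.
    by case: v => /=; rewrite ?expn_gt0 ?muln_gt0 ?(ltnW K1) ?(ltnW d1).
  have wK : prescribed_width v (elementary_K d) (elementary_w v d) by case: (v).
  apply: leq_trans (max_bitlen_bit_exponent w0 K1 dK wK) _; rewrite leq_exp2l //.
  apply: leq_trans (leq_mul constant_le (elementary_bit_exponent v (ltnW d1))) _.
  by rewrite -expnD leq_exp2l //; lia.
exists (bit_constant.+1%:R * (4 / ln 2))%R => d v d1 _ bound.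
have r0 := hua_r_gt0 d; have l0 : (0 < up_log 2 d)%N by rewrite up_log_gt0.
have exp_le : ((bit_constant.+1 * (hua_r d * up_log 2 d))%:R <=
    bit_constant.+1%:R * (4 / ln 2) * (Num.sqrt d%:R * ln d%:R) :> R)%R.
  by rewrite GRing.natrM -[leRHS]GRing.mulrA Num.Theory.ler_wpM2l // hua_exponent_bound.
split; apply: double_exponential_bound exp_le.
  apply: leq_trans (max_bitlen_hua_r_computation d1) _; rewrite leq_exp2l //.
  apply: leq_trans (ltnW (ltn_expl _ (isT : (1 < 2)%N))) _; rewrite leq_exp2l //.
  by rewrite leq_mul2l leq_pmull.
have K1 : (1 < hua_K d)%N by apply: leq_trans (leq_expn_pos _ r0); lia.
have dK : (d <= hua_K d)%N by apply: leq_trans (leq_expn_pos _ r0); lia.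
have w0 : (0 < hua_w v d)%N.
  case: v => /=; rewrite ?expn_gt0 ?muln_gt0 ?(ltnW K1) //; lia.
have wK : prescribed_width v (hua_K d) (hua_w v d) by case: (v).
apply: leq_trans (max_bitlen_bit_exponent w0 K1 dK wK) _; rewrite leq_exp2l //.
apply: leq_trans (leq_mul constant_le (hua_bit_exponent v d1)) _.
rewrite -expnD leq_exp2l //.
have : (0 < hua_r d * up_log 2 d)%N by rewrite muln_gt0 r0.
rewrite /bit_constant; lia.
Qed.
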